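(* Let $0<\alpha<1$ and let $G$ be a finite abelian group whose dual $\hat G$ carries a symmetric pairing $\langle\cdot,\cdot\rangle_{\hat G}$. For every sufficiently small $c>0$ there exists $K>0$, depending on $\alpha,G,c$, such that the following holds. Let $M$ be a random symmetric $n\times n$ integer matrix whose entries $m_{ij}\in\mathbb Z$, $i\le j$, are independent and $\alpha$-balanced mod $|G|$. Then \[\big|\mathbb E(\#\mathrm{Sur}^*(\mathrm{cok}(M),G))-|G|^{-1}\big|\le Ke^{-cn}.\]
   Context: $\mathrm{cok}(M)=\mathbb Z^n/M\mathbb Z^n$. $\alpha$-balanced mod $b$: for every prime $p\mid b$ and every $t\in\mathbb Z/p$, $\Pr(m_{ij}\equiv t\bmod p)\le 1-\alpha$. $\mathrm{Hom}(\mathrm{cok}(M),\mathbb Q/\mathbb Z)$ consists of $\phi:\mathbb Z^n\to\mathbb Q/\mathbb Z$ with $\phi M=0$ and carries the symmetric pairing $\langle x,y\rangle_M=XMY^t\bmod\mathbb Z$ for row-vector lifts $X,Y\in\mathbb Q^n$. $\mathrm{Sur}^*(\mathrm{cok}(M),G)$ is the set of surjective homomorphisms $F:\mathrm{cok}(M)\to G$ with $\langle u\circ F,v\circ F\rangle_M=\langle u,v\rangle_{\hat G}$ for all $u,v\in\hat G$. *)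

(* Defs.v *)
From HB Require Import structures.
From mathcomp Require Import all_boot all_order all_algebra.
From mathcomp Require Import finmap generic_quotient ring_quotient.
From mathcomp Require Import all_classical all_reals all_analysis.

Set Implicit Arguments.
Unset Strict Implicit.
Unset Printing Implicit Defensive.

Import Order.TTheory GRing.Theory Num.Theory.

Local Open Scope classical_set_scope.
Local Open Scope quotient_scope.
Local Open Scope ring_scope.

Definition int_in_rat : {pred rat} := fun q => q \is a Num.int.

Lemma int_in_rat_zmod_closed : zmod_closed int_in_rat.
Proof. by split=> [|x y]; [exact: rpred0|exact: rpredB]. Qed.

HB.instance Definition _ :=
  GRing.isZmodClosed.Build rat int_in_rat int_in_rat_zmod_closed.

Definition QmodZ : zmodType := Quotient.quot int_in_rat.
Definition toQmodZ (q : rat) : QmodZ := \pi_(Quotient.quot int_in_rat) q.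
Definition ofQmodZ (x : QmodZ) : rat := repr (x : Quotient.quot int_in_rat).

Lemma ofQmodZK : cancel ofQmodZ toQmodZ.
Proof. by move=> x; rewrite /toQmodZ /ofQmodZ reprK. Qed.

Lemma toQmodZ_eq (a b : rat) : toQmodZ a = toQmodZ b <-> a - b \is a Num.int.
Proof.
rewrite /toQmodZ; split=> [/eqmodP /=|h].
  by rewrite Quotient.equivE.
by apply/eqmodP; rewrite /= Quotient.equivE.
Qed.

Lemma toQmodZ_zmod_morphism : zmod_morphism toQmodZ.
Proof. by move=> a b; rewrite /toQmodZ !piE. Qed.

HB.instance Definition _ :=
  GRing.isZmodMorphism.Build rat QmodZ toQmodZ toQmodZ_zmod_morphism.

Lemma additive_ext (U V : zmodType) (f g : {additive U -> V}) :
  f =1 g -> f = g.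
Proof.
case: f g => f cf [g cg] /= /funext fg; subst g.
by congr (GRing.Additive.Pack _); case: cf cg => [[?]] [[?]];
   congr GRing.Additive.Class; congr GRing.isNmodMorphism.Axioms_;
   exact: Prop_irrelevance.
Qed.

Section cokernel.
Context {n : nat} (M : 'M[int]_n).

Definition colspan : {pred 'cV[int]_n} := fun v => `[< exists u, v = M *m u >].

Lemma colspan_zmod_closed : zmod_closed colspan.
Proof.
split; first by apply/asboolP; exists 0; rewrite mulmx0.
move=> _ _ /asboolP[u ->] /asboolP[v ->]; apply/asboolP.
by exists (u - v); rewrite mulmxBr.
Qed.

HB.instance Definition _ :=
  GRing.isZmodClosed.Build 'cV[int]_n colspan colspan_zmod_closed.

Definition cok : zmodType := Quotient.quot colspan.
Definition tocok (v : 'cV[int]_n) : cok := \pi_(Quotient.quot colspan) v.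

Lemma tocok_eq (u v : 'cV[int]_n) :
  tocok u = tocok v <-> exists w, u - v = M *m w.
Proof.
rewrite /tocok; split=> [/eqmodP /=|h].
  by rewrite Quotient.equivE => /asboolP.
by apply/eqmodP; rewrite /= Quotient.equivE; apply/asboolP.
Qed.

Lemma tocok_surj (x : cok) : exists v, tocok v = x.
Proof. by exists (repr x); rewrite /tocok reprK. Qed.

Lemma tocok_zmod_morphism : zmod_morphism tocok.
Proof. by move=> u v; rewrite /tocok !piE. Qed.

HB.instance Definition _ :=
  GRing.isZmodMorphism.Build 'cV[int]_n cok tocok tocok_zmod_morphism.

End cokernel.

Notation dual A := {additive A -> QmodZ}.

(* Additivity in the second argument follows from symmetry. *)
Record sym_pairing (A : zmodType) := SymPairing {
  pairing_fun :> dual A -> dual A -> QmodZ;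
  pairingDl : forall u v w : dual A,
    pairing_fun (u \+ v) w = pairing_fun u w + pairing_fun v w;
  pairingC : forall u v : dual A, pairing_fun u v = pairing_fun v u }.

Section cok_pairing.
Context {n : nat} (M : 'M[int]_n).
Implicit Types (x y : dual (cok M)) (X Y : 'rV[rat]_n).

Definition is_lift x X : Prop :=
  forall v : 'cV[int]_n, x (tocok M v) = toQmodZ ((X *m map_mx intr v) 0 0).

Definition some_lift x : 'rV[rat]_n :=
  \row_i ofQmodZ (x (tocok M (delta_mx i 0))).

(* [some_lift] is a lift, and when [M] is symmetric the value does not depend
   on the lifts: see [some_liftP] and [cok_pairingE]. *)
Definition cok_pairing x y : QmodZ :=
  toQmodZ ((some_lift x *m map_mx intr M *m (some_lift y)^T) 0 0).

Lemma some_liftP x : is_lift x (some_lift x).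
Proof.
move=> v; rewrite {1}[v]matrix_sum_delta.
under eq_bigr do rewrite big_ord1.
rewrite !raddf_sum /= mxE.
rewrite raddf_sum; apply: eq_bigr => i _.
rewrite !mxE mulrC -{1}[v i 0]intz scaler_int mulrzl !raddfMz.
by congr (_ *~ _); rewrite /= ofQmodZK.
Qed.

Lemma lift_mulmx_int x X : is_lift x X ->
  exists N : 'rV[int]_n, X *m map_mx intr M = map_mx intr N.
Proof.
move=> hX.
suff h j : (X *m map_mx intr M) 0 j \is a Num.int.
  exists (\row_j Num.floor ((X *m map_mx intr M) 0 j)).
  by apply/rowP => j; rewrite [RHS]mxE [X in X%:~R]mxE;
     apply/esym/eqP; rewrite -intrEfloor.
have := hX (col j M).
have -> : tocok M (col j M) = 0.
  rewrite -(raddf0 (tocok M)); apply/tocok_eq; exists (delta_mx j 0).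
  by rewrite subr0 colE.
rewrite raddf0 -(raddf0 toQmodZ) => /esym/toQmodZ_eq; rewrite subr0.
by rewrite map_col !colE mulmxA -colE mxE.
Qed.

Lemma lift_diff_int x X X' : is_lift x X -> is_lift x X' ->
  exists N : 'rV[int]_n, X - X' = map_mx intr N.
Proof.
move=> hX hX'.
suff h j : (X - X') 0 j \is a Num.int.
  exists (\row_j Num.floor ((X - X') 0 j)).
  by apply/rowP => j; rewrite [RHS]mxE [X in X%:~R]mxE;
     apply/esym/eqP; rewrite -intrEfloor.
have := hX (delta_mx j 0); rewrite hX' => /esym/toQmodZ_eq.
have e Z : (Z *m map_mx intr (delta_mx j 0 : 'cV[int]_n)) 0 0 = Z 0 j :> rat.
  by rewrite map_delta_mx -colE mxE.
by rewrite !e !mxE.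
Qed.

Lemma cok_pairingE x y X Y : M^T = M -> is_lift x X -> is_lift y Y ->
  cok_pairing x y = toQmodZ ((X *m map_mx intr M *m Y^T) 0 0).
Proof.
move=> symM hX hY.
have [A hA] := lift_diff_int (some_liftP x) hX.
have [B hB] := lift_diff_int (some_liftP y) hY.
have [C hC] := lift_mulmx_int (some_liftP y).
have [D hD] := lift_mulmx_int hX.
apply/toQmodZ_eq.
set Q := map_mx intr M in hC hD *.
have symQ : Q^T = Q by rewrite /Q map_trmx symM.
set x0 := some_lift x in hA *; set y0 := some_lift y in hB hC *.
have -> : (x0 *m Q *m y0^T) 0 0 - (X *m Q *m Y^T) 0 0 =
   (map_mx intr (A *m C^T + D *m B^T) : 'M[rat]_1) 0 0.
  rewrite map_mxD !map_mxM -!map_trmx -hA -hB -hC -hD trmx_mul symQ.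
  rewrite linearB mulmxBl mulmxBr !mulmxA.
  by rewrite !mxE addrA subrK.
by rewrite mxE intr_int.
Qed.

End cok_pairing.

Section surjections.
Context {n : nat} (M : 'M[int]_n) (G : finZmodType) (pG : sym_pairing G).

Definition Surstar : set {additive cok M -> G} :=
  [set F : {additive cok M -> G} |
    (forall g : G, exists x : cok M, F x = g) /\
    (forall u v : dual G, cok_pairing (u \o F) (v \o F) = pG u v)].

(* [classic] only supplies the choiceType structure needed by [fset_set];
   [fset_set] is the empty set on infinite sets, but [Surstar] is finite. *)
Definition num_Surstar : nat :=
  #|` fset_set (Surstar : set {classic {additive cok M -> G}})|.

Lemma Surstar_finite :
  finite_set (Surstar : set {classic {additive cok M -> G}}).
Proof.
pose ev (F : {classic {additive cok M -> G}}) : {ffun 'I_n -> G} :=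
  [ffun i => (F : {additive cok M -> G}) (tocok M (delta_mx i 0))].
have inj_ev : injective ev.
  move=> F1 F2 /ffunP e; apply/additive_ext => x.
  have [v <-] := tocok_surj x.
  rewrite [v]matrix_sum_delta; under eq_bigr do rewrite big_ord1.
  rewrite !raddf_sum; apply: eq_bigr => i _.
  rewrite -[v i 0]intz scaler_int !raddfMz; congr (_ *~ _).
  by have := e i; rewrite !ffunE.
have -> : (Surstar : set {classic {additive cok M -> G}}) =
    ev @^-1` (ev @` Surstar).
  apply/seteqP; split=> [F SF|F [F' SF' /inj_ev <-]//]; by exists F.
apply: finite_preimage; last exact: finite_finset.
by move=> ? ? _ _; exact: inj_ev.
Qed.

End surjections.

Section random.
Context {d : measure_display} {T : measurableType d} {R : realType}.
Variable P : probability T R.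

(* Measurability for the discrete sigma-algebra on [int]. *)
Definition int_random_variable (X : T -> int) : Prop :=
  forall A : set int, measurable (X @^-1` A).

Definition mutually_independent (I : finType) (D : {set I}) (X : I -> T -> int)
    : Prop :=
  forall J : {set I}, J \subset D -> forall A : I -> set int,
    P (\bigcap_(i in [set` J]) X i @^-1` A i) =
    (\prod_(i in J) P (X i @^-1` A i))%E.

Definition balanced (alpha : R) (b : nat) (X : T -> int) : Prop :=
  forall p : nat, prime p -> (p %| b)%N ->
  forall t : 'F_p, (P [set w | (X w)%:~R = t] <= (1 - alpha)%:E)%E.

Definition random_sym_matrix (alpha : R) (b n : nat) (M : T -> 'M[int]_n)
    : Prop :=
  [/\ forall i j, int_random_variable (fun w => M w i j),
      forall w, (M w)^T = M w,
      mutually_independent [set ij : 'I_n * 'I_n | (ij.1 <= ij.2)%N]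
        (fun ij w => M w ij.1 ij.2) &
      forall i j : 'I_n, (i <= j)%N -> balanced alpha b (fun w => M w i j)].

End random.

(* Main.v *)
Require Import Defs.
From HB Require Import structures.
From mathcomp Require Import all_boot all_order all_algebra all_fingroup all_solvable all_field.
From mathcomp Require Import finmap complex.
From mathcomp Require Import all_classical all_reals all_analysis measurable_realfun.
From mathcomp Require Import zify ring lra.

Set Implicit Arguments.
Unset Strict Implicit.
Unset Printing Implicit Defensive.

Import Order.TTheory GRing.Theory Num.Theory.

Local Open Scope ring_scope.

(** A homomorphism from the cokernel to [G] is a sequence [f] in [G^n], and the
    conditions defining [Sur*] are linear in the entries of the matrix modulo
    [N = |G|^2].  Expanding their indicators in characters of [Z/N], with one
    dual vector [c_k] per column and one dual matrix [d] for the pairing, turns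
    the expected number into an average over [d] of sums over
    [y_k = (f_k, c_k)] of products of the Fourier coefficients of the entries
    at [B_d (y_k, y_l)], [k < l], and [q_d (y_k)], where [q_d] is a quadratic
    form with polar form [B_d] on a finite module [V].  A Fourier coefficient
    is [1] at [0] and bounded by some [rho < 1] elsewhere.  Looking at the
    values taken by [y] a positive proportion of the time shows that, up to an
    exponentially small error, only the [y] filling a subgroup [H] on which
    [q_d] vanishes and [|H|^2 = |V| |rad B_d|] matter.  Among these, the [H] that
    map onto [G] are graphs of linear maps; counting the pairs [(d, H)] gives
    exactly [1 / |G|].  Since the whole sum over [y] is treated at once, no
    distinction between well distributed and degenerate [f] is needed. *)

(** The number of sequences [y] is [|V|^n], while the normalization is only [D^n] with
    [D^2 >= |V| |rad B_d|], so a weight that grows linearly in [n] at a small rate cannot control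
    the sum by itself. Sorting by popular values resolves this: a popular set that is not isotropic
    forces a weight quadratic in [n], an isotropic one has at most [D] elements, and only the case
    of equality survives division by [D^n]. The value [1 / |G|] comes from pairs [(C, d)] such that
    [q_d] vanishes on the graph of [C]. For fixed [C] the entries of [d] are constrained
    independently, which leaves a fraction [|G|^-(r+1)] of all [d]; on the other side, all the
    matrices [C] together have only [|G|^r] distinct graphs. The prescribed pairing enters through a
    phase, equal to [1] on such pairs. The modulus [|G|^2] comes from pairings of dual basis
    vectors, whose denominators are products [a_i a_j]. Its prime factors are those of [|G|], so
    balance modulo [|G|] is enough. A diagonal entry of the matrix occurs once and the others twice,
    whence a quadratic form together with its polar form. *)

Section RealPowers.
Variable R : realType.
Implicit Types x e : R.

Lemma bernoulli_ge x m : 0 <= x -> x <= 1 -> 1 - m%:R * x <= (1 - x) ^+ m.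
Proof.
move=> x0 x1; elim: m => [|m IH]; first by rewrite mul0r subr0 expr0.
rewrite exprS -natr1; have : 0 <= m%:R * x * x by rewrite !mulr_ge0.
have : (1 - x) * (1 - m%:R * x) <= (1 - x) * (1 - x) ^+ m.
  by rewrite ler_wpM2l // subr_ge0.
by nra.
Qed.

(** Bernoulli's inequality replaces an actual root: for [m > 0], [t = 1 - (1 - x) / (2 * m)] has
    [t ^+ m >= (1 + x) / 2]. *)
Lemma root_below_one x m : 0 <= x -> x < 1 ->
  exists t : R, [/\ 0 < t, t < 1 & x <= t ^+ m].
Proof.
move=> x0 x1; case: m => [|m].
  by exists (1 / 2); split; rewrite ?expr0; lra.
have m0 : 0 < (m.+1%:R : R) by rewrite ltr0n.
have m1 : 1 <= (m.+1%:R : R) by rewrite ler1n.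
pose h := (1 - x) / (2 * m.+1%:R).
have hm : m.+1%:R * h = (1 - x) / 2.
  by rewrite /h; move: (m.+1%:R) m0 => M M0; field; rewrite gt_eqF.
have h0 : 0 < h by rewrite /h divr_gt0 //; nra.
have h1 : h < 1 by nra.
exists (1 - h); split; [lra|lra|].
have := bernoulli_ge m.+1 (ltW h0) (ltW h1); rewrite hm; lra.
Qed.

Lemma root_above_one x m : 1 < x -> exists2 t : R, 1 < t & t ^+ m <= x.
Proof.
move=> x1; have x0 : 0 < x by lra.
have [] := @root_below_one x^-1 m; [by rewrite invr_ge0 ltW|by rewrite invf_lt1|].
move=> t [t0 t1 ht]; exists t^-1; first by rewrite invf_gt1.
by rewrite exprVn -[leRHS]invrK lef_pV2 // posrE ?invr_gt0 ?exprn_gt0.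
Qed.

Lemma pow_eventually_small x e : 0 <= x -> x < 1 -> 0 < e ->
  exists n0, forall n, (n0 <= n)%N -> x ^+ n <= e.
Proof.
move=> x0 x1 e0.
have [->|xn0] := eqVneq x 0.
  by exists 1%N => -[//|n] _; rewrite exprS mul0r ltW.
have xgt0 : 0 < x by rewrite lt_def xn0.
pose h := x^-1 - 1; have h0 : 0 < h by rewrite subr_gt0 invf_gt1.
have bern m : 1 + m%:R * h <= x ^- m.
  rewrite -exprVn; elim: m => [|m IH]; first by rewrite mul0r addr0 expr0.
  rewrite exprS -natr1 (_ : x^-1 = 1 + h); last by rewrite /h; lra.
  have : (1 + h) * (1 + m%:R * h) <= (1 + h) * x^-1 ^+ m.
    by rewrite ler_wpM2l //; lra.
  have -> : x^-1 = 1 + h by rewrite /h; lra.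
  have : 0 <= m%:R * h * h by rewrite !mulr_ge0 // ltW.
  by nra.
have /archi_boundP : 0 <= e^-1 / h by apply: divr_ge0; rewrite ?invr_ge0 ltW.
set n0 := Num.bound _ => hn0; exists n0 => n hn.
have : e^-1 <= x ^- n.
  apply: le_trans (bern n); move: hn0; rewrite ltr_pdivrMr // => hn0.
  have : n0%:R * h <= n%:R * h by rewrite ler_wpM2r ?ler_nat // ltW.
  lra.
by rewrite lef_pV2 // posrE ?exprn_gt0.
Qed.

Lemma pow_eventually_large x e : 1 < x -> exists n, e <= x ^+ n.
Proof.
move=> x1; have x0 : 0 < x by lra.
have [e0|e0] := lerP e 0; first by exists 0%N; rewrite expr0; lra.
have [] := @pow_eventually_small x^-1 e^-1; rewrite ?invr_ge0 ?invr_gt0 ?ltW //.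
  by rewrite invf_lt1.
move=> n /(_ n (leqnn n)); rewrite exprVn lef_pV2 ?posrE ?exprn_gt0 //.
by move=> h; exists n.
Qed.

End RealPowers.

(** * Popular values of a sequence and its weight *)

Section Popular.
Variables (V : finType) (Bz : rel V) (qz : pred V).

Definition isotropic (P : {set V}) := [forall x in P, forall y in P, Bz x y].
Definition perp (P : {set V}) : {set V} := [set x | [forall p in P, Bz p x]]%SET.

Lemma isotropicP (P : {set V}) :
  reflect {in P &, forall x y, Bz x y} (isotropic P).
Proof.
apply: (iffP forall_inP) => [h x y xP yP|h x xP]; first exact: (forall_inP (h x xP)).
by apply/forall_inP => y; exact: h.
Qed.

Lemma perpP (P : {set V}) x : reflect {in P, forall p, Bz p x} (x \in perp P).
Proof. by rewrite inE; exact: forall_inP. Qed.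

Variables (n L : nat).
Implicit Types (y : {ffun 'I_n -> V}) (P : {set V}).

Definition occ y x := (\sum_k (y k == x : nat))%N.
(** Values taken at least [n / L] times. For [n = 0] this is all of [V], so that case is split off
    later. *)
Definition pop y : {set V} := [set x | (n <= L * occ y x)%N]%SET.
Definition wt_off y :=
  (\sum_(k < n) \sum_(l < n) ((k < l) && ~~ Bz (y k) (y l) : nat))%N.
Definition wt_diag y := (\sum_(k < n) (~~ qz (y k) : nat))%N.
(** Counts the entries on or above the diagonal whose Fourier coefficient is taken away from [0];
    each costs a factor [rho]. *)
Definition wt y := (wt_off y + wt_diag y)%N.
Definition outside P y := (\sum_k (y k \notin P : nat))%N.

(** If [y l] is not orthogonal to a popular [p], every position of [p] other than [l] forms a bad
    pair with [l], and there are at least [n / L] positions of [p]. Discarding [l] itself explains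
    [n - L]; the factor [2] is there because a bad pair may be charged from both ends. *)
Lemma outside_perp_wt y : symmetric Bz ->
  (outside (perp (pop y)) y * (n - L) <= 2 * L * wt_off y)%N.
Proof.
move=> symB.
rewrite -mulnA mulnCA; have -> : (2 * wt_off y =
    \sum_(l < n) \sum_(k < n) ((k != l) && ~~ Bz (y k) (y l) : nat))%N.
  rewrite mul2n -addnn {1}/wt_off exchange_big /wt_off /= -big_split /=.
  apply: eq_bigr => l _; rewrite -big_split /=; apply: eq_bigr => k _.
  rewrite [Bz (y l) _]symB -val_eqE /=.
  by case: ltngtP => //= _; case: (Bz _ _).
rewrite big_distrr big_distrl /=; apply: leq_sum => l _.
case: (boolP (y l \in _)) => //= /perpP nperp.
have [p pP npl] : exists2 p, p \in pop y & ~~ Bz p (y l).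
  apply/exists_inP; apply: contra_notT nperp; rewrite negb_exists_in.
  by move/forall_inP => h p /h; rewrite negbK.
have : (occ y p <= 1 + \sum_(k < n) ((k != l) && ~~ Bz (y k) (y l) : nat))%N.
  rewrite /occ (bigD1 l) //= leq_add //; first by case: eqP.
  rewrite [leqRHS](bigD1 l) //= eqxx add0n; apply: leq_sum => k kl.
  by rewrite kl /=; case: eqP => // ->; rewrite npl.
move: pP; rewrite inE => pP hocc; rewrite mul1n leq_subLR -mulnS.
by apply: leq_trans pP _; rewrite leq_mul2l hocc orbT.
Qed.

Lemma occ_wt_diag y x : ~~ qz x -> (occ y x <= wt_diag y)%N.
Proof. by move=> qx; apply: leq_sum => k _; case: eqP => // ->; rewrite qx. Qed.

Lemma occ_outside y P x : x \notin P -> (occ y x <= outside P y)%N.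
Proof. by move=> xP; apply: leq_sum => k _; case: eqP => // ->; rewrite xP. Qed.

(** Each of the at most [#|V|] unpopular values occupies fewer than [n / L] positions. *)
Lemma outside_pop y : (L * outside (pop y) y <= #|V| * n)%N.
Proof.
have -> : outside (pop y) y = (\sum_(x | x \notin pop y) occ y x)%N.
  rewrite exchange_big /=; apply: eq_bigr => k _.
  case: (boolP (y k \in pop y)) => h /=.
    by rewrite big1 // => x xP; case: eqP => // e; rewrite -e h in xP.
  by rewrite (bigD1 (y k)) //= eqxx big1 ?addn0 // => x /andP[_ /negPf]; rewrite eq_sym => ->.
rewrite big_distrr /= -sum_nat_const [leqRHS](bigID [pred x | x \in pop y]) /=.
apply: leq_trans (leq_addl _ _); apply: leq_sum => x.
by rewrite inE -ltnNge => /ltnW.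
Qed.

Lemma outside_gt0 y P : ~~ [forall k, y k \in P] -> (0 < outside P y)%N.
Proof.
by rewrite negb_forall => /existsP[k kP]; rewrite /outside (bigD1 k) //= kP.
Qed.

Variable R : realType.

Lemma sum_ffun_prod (w : V -> R) :
  \sum_(y : {ffun 'I_n -> V}) \prod_k w (y k) = (\sum_x w x) ^+ n.
Proof. by rewrite -(bigA_distr_bigA (fun _ => w)) /= prodr_const card_ord. Qed.

Lemma prod_pow_outside (s : R) P y :
  \prod_k (if y k \in P then 1 else s) = s ^+ outside P y.
Proof.
rewrite /outside expr_sum; apply: eq_bigr => k _.
by case: (_ \in _); rewrite /= ?expr0 ?expr1.
Qed.

Lemma sum_weight P (s : R) :
  \sum_x (if x \in P then 1 else s) = #|P|%:R + #|~: P|%:R * s.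
Proof.
rewrite (bigID [in P]) /=; congr (_ + _).
  by under eq_bigr => x -> do []; rewrite sumr_const.
rewrite (eq_bigr (fun=> s)) => [|x /negPf ->//].
rewrite sumr_const mulr_natl; congr (_ *+ _).
by apply: eq_card => x; rewrite !inE.
Qed.

Lemma sum_pow_outside P (s : R) : 0 <= s ->
  \sum_(y : {ffun 'I_n -> V}) s ^+ outside P y <= (#|P|%:R + #|V|%:R * s) ^+ n.
Proof.
move=> s0; under eq_bigr do rewrite -prod_pow_outside.
rewrite (sum_ffun_prod (fun x => if x \in P then 1 else s)) sum_weight.
rewrite lerXn2r ?nnegrE ?addr_ge0 ?mulr_ge0 // lerD2l ler_wpM2r //.
by rewrite ler_nat max_card.
Qed.

(** Exponential moment argument: give [y] the weight [(A ^+ #|V|) ^+ n * s ^+ outside P y] with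
    [s = 1 / (2 * #|V|)]. By [outside_pop] and [1 / s <= A ^+ L] it is at least [1] when [pop y] is
    [P], and its total over all [y] factors over the positions. *)
Lemma count_pop_le (A : R) P : 1 <= A -> (0 < #|V|)%N -> 2 * #|V|%:R <= A ^+ L ->
  (\sum_(y : {ffun 'I_n -> V} | pop y == P) 1 <= (A ^+ #|V| * (#|P|%:R + 1 / 2)) ^+ n :> R).
Proof.
move=> A1 V0 AL; have A0 : 0 < A by lra.
have v0 : 0 < #|V|%:R :> R by rewrite ltr0n.
pose s : R := (2 * #|V|%:R)^-1.
have s0 : 0 < s by rewrite invr_gt0 mulr_gt0.
apply: (@le_trans _ _ (\sum_(y : {ffun 'I_n -> V}) (A ^+ #|V|) ^+ n * s ^+ outside P y)).
  rewrite [leRHS](bigID [pred y | pop y == P]) /=.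
  rewrite -[leLHS]addr0 lerD //.
    apply: ler_sum => y /eqP <-.
    rewrite /s exprVn ler_pdivlMr ?exprn_gt0 ?mulr_gt0 // mul1r.
    apply: (@le_trans _ _ ((A ^+ L) ^+ outside (pop y) y)).
      by rewrite lerXn2r ?nnegrE ?mulr_ge0 ?exprn_ge0 // ltW.
    by rewrite -!exprM ler_weXn2l // outside_pop.
  by apply: sumr_ge0 => y _; rewrite mulr_ge0 ?exprn_ge0 // ltW.
rewrite -mulr_sumr exprMn ler_wpM2l ?exprn_ge0 ?(ltW A0) //.
apply: le_trans (sum_pow_outside P (ltW s0)) _.
by rewrite /s invfM mulrCA divff ?gt_eqF // mulr1 div1r.
Qed.

End Popular.

(** * Exponential bounds away from Lagrangian popular sets *)

Section PopularSum.
Variables (R : realType) (V : finType) (Bz : rel V) (qz : pred V) (D : nat).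
Variable rho : R.
Hypotheses (symB : symmetric Bz) (D_gt0 : (0 < D)%N) (V_gt0 : (0 < #|V|)%N).
Hypotheses (rho_ge0 : 0 <= rho) (rho_lt1 : rho < 1).
Hypothesis card_isotropic : forall P, isotropic Bz P -> (#|P| <= D)%N.
Hypothesis perp_isotropic :
  forall P, isotropic Bz P -> #|P| = D -> perp Bz P \subset P.

Definition lagrangian (P : {set V}) :=
  [&& isotropic Bz P, #|P| == D & [forall x in P, qz x]].

Lemma pow_wt_le (t : R) m w e : 0 < t -> t < 1 -> rho <= t ^+ m ->
  (e <= m * w)%N -> rho ^+ w <= t ^+ e.
Proof.
move=> t0 t1 rt ew; apply: (@le_trans _ _ ((t ^+ m) ^+ w)).
  by rewrite lerXn2r ?nnegrE ?exprn_ge0 // ltW.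
by rewrite -exprM ler_wiXn2l // ltW.
Qed.

(** Some popular value lies outside the perp of the popular set. It has at least [n / L] positions
    and each costs a weight of order [n], so the total is quadratic in [n] and beats the count
    [#|V| ^ n]. *)
Lemma wt_not_isotropic n L (y : {ffun 'I_n -> V}) :
  ~~ isotropic Bz (pop L y) -> (n * (n - L) <= 2 * L * L * wt Bz qz y)%N.
Proof.
move=> niso; have [p pP pperp] : exists2 p, p \in pop L y & p \notin perp Bz (pop L y).
  apply/exists_inP; apply: contraNT niso; rewrite negb_exists_in => /forall_inP h.
  by apply/isotropicP => x z /[swap] /h; rewrite negbK => /perpP; apply.
have := occ_outside y pperp; have := @outside_perp_wt V Bz n L y symB.
move: pP; rewrite inE /wt => h1 h2 h3.
apply: leq_trans (_ : (L * outside (perp Bz (pop L y)) y * (n - L) <= _)%N).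
  by rewrite leq_mul2r (leq_trans h1) ?orbT // leq_mul2l h3 orbT.
rewrite -mulnA [in leqRHS]mulnAC mulnC leq_mul2r mulnDr.
by rewrite (leq_trans h2) ?leq_addr ?orbT.
Qed.

(** The term in [outside] makes stray entries summable, the lone [n - L] gives the exponential gain.
    Strays lie outside the perp, hence cost weight. The lone term comes from a popular value at
    which the form is not zero or, failing that, from one stray counted a second time, which doubles
    [2 * L]. *)
Lemma wt_not_lagrangian n L (y : {ffun 'I_n -> V}) :
  (L <= n)%N -> isotropic Bz (pop L y) -> #|pop L y| = D ->
  ~~ (lagrangian (pop L y) && [forall k, y k \in pop L y]) ->
  ((n - L) + (n - L) * outside (pop L y) y <= 4 * L * wt Bz qz y)%N.
Proof.
move=> Ln iso cardP; rewrite /lagrangian iso cardP eqxx /= => nlag.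
have h2 := @outside_perp_wt V Bz n L y symB.
have h3 : (outside (pop L y) y <= outside (perp Bz (pop L y)) y)%N.
  apply: leq_sum => k _; case: (boolP (y k \in perp _ _)) => [|_]; last by case: (_ \in _).
  by move/(fintype.subsetP (perp_isotropic iso cardP)) ->.
have h4 : (outside (pop L y) y * (n - L) <= 2 * L * wt_off Bz y)%N.
  by apply: leq_trans h2; rewrite leq_mul2r h3 orbT.
rewrite mulnC in h4; rewrite /wt; move: nlag; rewrite negb_and => /orP[|].
  rewrite negb_forall_in => /exists_inP[x xP qx].
  have := occ_wt_diag y qx; move: xP; rewrite inE => h5 h6.
  have : (n <= L * wt_diag qz y)%N by apply: leq_trans h5 _; rewrite leq_mul2l h6 orbT.
  rewrite !mulnDr; move: h4; set u := (_ * outside _ _)%N; rewrite -!mulnA.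
  by set v := (L * wt_off _ _)%N; set w := (L * wt_diag _ _)%N; lia.
move=> /outside_gt0 h5.
have : (n - L <= (n - L) * outside (pop L y) y)%N by rewrite leq_pmulr.
rewrite !mulnDr; move: h4; set u := (_ * outside _ _)%N; rewrite -!mulnA.
by set v := (L * wt_off _ _)%N; lia.
Qed.

(* Sequences with a given popular set [P]: either [P] is not isotropic and the
   weight is quadratic in [n], or [#|P| < D] and there are too few sequences,
   or [P] is a maximal isotropic set and each entry outside it, or each
   popular entry that is not a zero of the form, costs weight linear in [n]. *)
Lemma popular_class_bound : exists L n0 : nat, exists tau K : R,
  [/\ 0 < tau, tau < 1, 0 <= K & forall n, (n0 <= n)%N -> forall P : {set V},
    ((#|P| < D)%N ->
      \sum_(y : {ffun 'I_n -> V} | pop L y == P) 1 <= K * tau ^+ n * D%:R ^+ n) /\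
    \sum_(y : {ffun 'I_n -> V} | (pop L y == P) &&
        ~~ (lagrangian (pop L y) && [forall k, y k \in pop L y]))
      rho ^+ wt Bz qz y <= K * tau ^+ n * D%:R ^+ n].
Proof.
have d1 : 1 <= D%:R :> R by rewrite ler1n.
set dd : R := D%:R in d1 *; have dd0 : 0 <= dd by lra.
(* For [#|P| <= D - 1], [count_pop_le] gives a base at most [(1 + 1 / (2D)) * (D - 1 / 2) = (1 - 1 /
   (4 D^2)) * D]. This fixes [A] here and [ta] below. *)
have c1 : 1 < 1 + (2 * dd)^-1 by rewrite ltrDl invr_gt0; lra.
have [A A1 AV] := root_above_one #|V| c1.
have [L AL] := @pow_eventually_large R A (2 * #|V|%:R) A1.
have [r1 [r10 r11 rr1]] := root_below_one (2 * L * L) rho_ge0 rho_lt1.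
have [r2 [r20 r21 rr2]] := root_below_one (4 * L) rho_ge0 rho_lt1.
have v0 : 0 < #|V|%:R :> R by rewrite ltr0n.
have [] := @pow_eventually_small R r1 (1 / 2 / #|V|%:R) (ltW r10) r11.
  by rewrite divr_gt0 //; lra.
move=> n1 hn1.
have [] := @pow_eventually_small R r2 ((1 - r2) / #|V|%:R) (ltW r20) r21.
  by rewrite divr_gt0 //; lra.
move=> n2 hn2.
pose ta := 1 - (4 * dd ^+ 2)^-1.
have dd2 : 1 <= dd ^+ 2 by rewrite exprn_ege1.
have inv0 : 0 < (4 * dd ^+ 2)^-1 by rewrite invr_gt0; lra.
have inv1 : (4 * dd ^+ 2)^-1 <= 1 / 4.
  rewrite -[1 / 4]invrK lef_pV2 ?posrE ?invr_gt0; lra.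
(* [t2 = 1 - (1 - r2)^2]: a factor [r2] per position from the lone [n - L], and a factor at most
   [2 - r2] from the strays once [#|V| * r2 ^+ (n - L) <= 1 - r2]. *)
pose t2 := r2 * (2 - r2).
have t20 : 0 < t2 by rewrite /t2 mulr_gt0; lra.
have t21 : t2 < 1 by rewrite /t2; nra.
pose tau := Num.max (1 / 2) (Num.max ta t2).
have tau1 : tau < 1 by rewrite /tau !gt_max t21 /ta; lra.
have tau_h : 1 / 2 <= tau by rewrite /tau !le_max lexx.
have tau_a : ta <= tau by rewrite /tau !le_max lexx !orbT.
have tau_2 : t2 <= tau by rewrite /tau !le_max lexx !orbT.
have tau0 : 0 < tau by lra.
have K0 : 1 <= r2 ^- L by rewrite -exprVn exprn_ege1 // invf_ge1 // ltW.
have K1 : forall n, tau ^+ n * dd ^+ n <= r2 ^- L * tau ^+ n * dd ^+ n.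
  move=> n; rewrite -mulrA ler_peMl // mulr_ge0 // exprn_ge0 //; lra.
exists L, (L + n1 + n2)%N, tau, (r2 ^- L); split=> //; first lra.
move=> n nn P.
have nL1 : (n1 <= n - L)%N by move: nn; clear; lia.
have nL2 : (n2 <= n - L)%N by move: nn; clear; lia.
have nL : (L <= n)%N by move: nn; clear; lia.
have small : (#|P| < D)%N -> \sum_(y : {ffun 'I_n -> V} | pop L y == P) 1 <=
    r2 ^- L * tau ^+ n * dd ^+ n :> R.
  move=> PD; apply: le_trans (@count_pop_le V n L R A P (ltW A1) V_gt0 AL) _.
  have Ap : 0 <= A ^+ #|V| by rewrite exprn_ge0 //; lra.
  have Pp : 0 <= #|P|%:R + 1 / 2 :> R by have := ler0n R #|P|; lra.
  apply: le_trans (K1 n); rewrite -exprMn lerXn2r ?nnegrE ?mulr_ge0 ?(ltW tau0) //.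
  have P1 : #|P|%:R + 1 <= dd by rewrite /dd natr1 ler_nat.
  apply: (@le_trans _ _ ((1 + (2 * dd)^-1) * (dd - 1 / 2))).
    by apply: ler_pM => //; lra.
  apply: (@le_trans _ _ (ta * dd)); last by rewrite ler_wpM2r //; lra.
  rewrite /ta le_eqVlt; apply/orP; left; apply/eqP; field; apply/eqP; lra.
split=> //.
have [iso|niso] := boolP (isotropic Bz P); last first.
  apply: (@le_trans _ _ (\sum_(y : {ffun 'I_n -> V}) (r1 ^+ (n - L)) ^+ n)).
    rewrite big_mkcond /=; apply: ler_sum => y _.
    case: ifP => [/andP[/eqP PE _]|_]; last by rewrite !exprn_ge0 // ltW.
    rewrite -exprM mulnC; apply: pow_wt_le rr1 _ => //.
    by apply: wt_not_isotropic; rewrite PE.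
  rewrite sumr_const card_ffun card_ord -mulr_natl natrX -exprMn.
  apply: le_trans (K1 n); rewrite -exprMn lerXn2r ?nnegrE ?mulr_ge0 ?exprn_ge0 //; try lra.
  move: (hn1 _ nL1); rewrite ler_pdivlMr // mulrC => h; apply: le_trans h _.
  by apply: le_trans tau_h _; rewrite ler_peMr // ltW.
have := card_isotropic iso; rewrite leq_eqVlt => /orP[/eqP PD|PD]; last first.
  apply: le_trans (small PD); rewrite big_mkcondr /=; apply: ler_sum => y _.
  by case: ifP => // _; rewrite exprn_ile1 // ltW.
apply: (@le_trans _ _ (\sum_(y : {ffun 'I_n -> V})
    r2 ^+ (n - L) * (r2 ^+ (n - L)) ^+ outside P y)).
  rewrite big_mkcond /=; apply: ler_sum => y _.
  case: ifP => [/andP[/eqP PE nl]|_]; last by rewrite mulr_ge0 ?exprn_ge0 // ltW.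
  rewrite -exprM -exprD; apply: pow_wt_le rr2 _ => //.
  rewrite -PE; apply: wt_not_lagrangian; rewrite ?PE //.
  by move: nl; rewrite PE.
rewrite -mulr_sumr.
apply: (@le_trans _ _ (r2 ^+ (n - L) * (dd * (2 - r2)) ^+ n)).
  rewrite ler_wpM2l ?exprn_ge0 ?(ltW r20) //.
  apply: le_trans (sum_pow_outside _ _ _) _; first by rewrite exprn_ge0 // ltW.
  rewrite PD lerXn2r ?nnegrE ?addr_ge0 ?mulr_ge0 ?exprn_ge0 ?(ltW r20) //; try lra.
  move: (hn2 _ nL2); rewrite ler_pdivlMr // mulrC -/dd => h.
  have : 1 * (1 - r2) <= dd * (1 - r2) by rewrite ler_wpM2r //; lra.
  lra.
have -> : r2 ^+ (n - L) = r2 ^- L * r2 ^+ n.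
  rewrite -{2}(subnKC nL).
  by rewrite exprD mulrA mulVf ?mul1r // expf_neq0 // gt_eqF.
rewrite -[leLHS]mulrA -exprMn -[leRHS]mulrA -exprMn ler_wpM2l //; first lra.
rewrite mulrCA -/t2 [tau * _]mulrC lerXn2r ?nnegrE ?mulr_ge0 ?(ltW tau0) //; [lra|lra|].
by rewrite ler_wpM2l.
Qed.

(** There are finitely many popular sets, so the class bounds add up. In the second bound, a
    sequence inside [H] has its popular set inside [H]; if the two differ, that set has fewer than
    [D] elements. *)
Lemma popular_sum_bound : exists L : nat, exists tau K : R,
  [/\ 0 < tau, tau < 1, 0 <= K & forall n,
    \sum_(y : {ffun 'I_n -> V} |
        ~~ (lagrangian (pop L y) && [forall k, y k \in pop L y]))
      rho ^+ wt Bz qz y <= K * tau ^+ n * D%:R ^+ n /\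
    forall H : {set V}, #|H| = D ->
      \sum_(y : {ffun 'I_n -> V} | [forall k, y k \in H] && (pop L y != H)) 1 <=
        K * tau ^+ n * D%:R ^+ n].
Proof.
have [L [n0' [tau [K [tau0 tau1 K0 hK]]]]] := popular_class_bound.
(* The successor makes [n] positive in the main range, so that popular values do occur in the
   sequence. *)
pose n0 := n0'.+1.
have d1 : 1 <= D%:R :> R by rewrite ler1n.
(* The second summand absorbs the finitely many [n < n0], where all sequences are counted. *)
pose K1 := #|{set V}|%:R * K + #|V|%:R ^+ n0 * tau ^- n0.
have v1 : 1 <= #|V|%:R :> R by rewrite ler1n.
have K00 : 0 <= #|{set V}|%:R * K by rewrite mulr_ge0.
have K01 : 0 <= #|V|%:R ^+ n0 * tau ^- n0.
  by rewrite mulr_ge0 ?invr_ge0 ?exprn_ge0 ?(ltW tau0).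
have td0 n : 0 <= tau ^+ n * D%:R ^+ n by rewrite mulr_ge0 ?exprn_ge0 ?(ltW tau0).
exists L, tau, K1; split=> //; first by rewrite addr_ge0.
move=> n; have [nn|nn] := leqP n0 n; last first.
  have triv (Q : pred {ffun 'I_n -> V}) (F : {ffun 'I_n -> V} -> R) :
      (forall y, 0 <= F y <= 1) -> \sum_(y | Q y) F y <= K1 * tau ^+ n * D%:R ^+ n.
    move=> F01; apply: (@le_trans _ _ (\sum_(y : {ffun 'I_n -> V}) 1)).
      rewrite big_mkcond /=; apply: ler_sum => y _.
      by case: ifP => _ //; have /andP[] := F01 y.
    rewrite sumr_const card_ffun card_ord natrX -mulrA.
    apply: (@le_trans _ _ (#|V|%:R ^+ n0 * tau ^- n0 * (tau ^+ n * D%:R ^+ n))).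
      rewrite -mulrA mulrA [leRHS]mulrA; apply: le_trans (_ : _ <= #|V|%:R ^+ n0 * 1) _.
        by rewrite mulr1; apply: ler_weXn2l => //; exact: ltnW.
      rewrite -!mulrA ler_wpM2l ?exprn_ge0 // mulrA.
      rewrite mulr_ege1 ?exprn_ege1 // mulrC ler_pdivlMr ?exprn_gt0 // mul1r.
      by apply: ler_wiXn2l; [exact: ltW|exact: ltW|exact: ltnW].
    by rewrite ler_wpM2r // /K1 lerDr.
  split=> [|H _]; apply: triv => y; last by rewrite ler01 lexx.
  by rewrite exprn_ge0 ?exprn_ile1 // ltW.
have tot : #|{set V}|%:R * (K * tau ^+ n * D%:R ^+ n) <= K1 * tau ^+ n * D%:R ^+ n.
  by rewrite -!mulrA mulrA ler_wpM2r // /K1 lerDl.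
have pos : 0 <= K * tau ^+ n * D%:R ^+ n by rewrite -mulrA mulr_ge0.
split=> [|H HD]; apply: le_trans tot.
  rewrite (partition_big (pop L) xpredT) //=.
  rewrite mulr_natl -sumr_const; apply: ler_sum => P _.
  have [_ h] := hK n (ltnW nn) P; apply: le_trans h.
  by rewrite le_eqVlt (eq_bigl _ _ (fun y => andbC _ _)) eqxx.
rewrite (partition_big (pop L) xpredT) //= mulr_natl -sumr_const.
apply: ler_sum => P _.
have [PD|PD] := ltnP #|P| D.
  have [/(_ PD) h _] := hK n (ltnW nn) P; apply: le_trans h.
  rewrite [leLHS]big_mkcond [leRHS]big_mkcond; apply: ler_sum => y _ /=.
  by case: (pop L y == P); rewrite ?andbT ?andbF //; case: ifP.
rewrite big_pred0 // => y; apply/negbTE/negP => /andP[/andP[/forallP yH popH] /eqP PE].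
move: popH; rewrite PE => /negP; apply; rewrite eqEcard HD PD andbT -PE.
apply/fintype.subsetP => x; rewrite inE => xpop.
have [k /eqP <-//] : exists k, y k == x.
apply/existsP; apply: contraLR xpop; rewrite negb_exists => /forallP h.
by rewrite /occ big1 ?muln0 -?ltnNge; [lia|move=> k _; rewrite (negPf (h k))].
Qed.

End PopularSum.

(** * Characters of [Z/N] and perpendicular sets *)

Section Character.
Variables (F : numFieldType) (N : nat) (z : F).
Hypotheses (N_gt1 : (1 < N)%N) (prim_z : N.-primitive_root z).
Implicit Types x y : 'Z_N.

Definition chr x : F := z ^+ x.

Lemma chr_nat (m : nat) : chr m%:R = z ^+ m.
Proof. by rewrite /chr Zp_nat /= Zp_cast // (prim_expr_mod prim_z). Qed.

Lemma chr0 : chr 0 = 1. Proof. by rewrite /chr expr0. Qed.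

Lemma chrD x y : chr (x + y) = chr x * chr y.
Proof. by rewrite -{1}[x]natr_Zp -{1}[y]natr_Zp -natrD chr_nat exprD. Qed.

Lemma chr_sum (I : Type) (s : seq I) (P : pred I) (f : I -> 'Z_N) :
  chr (\sum_(i <- s | P i) f i) = \prod_(i <- s | P i) chr (f i).
Proof. exact: (big_morph chr chrD chr0). Qed.

Lemma chr_eq1 x : (chr x == 1) = (x == 0).
Proof.
rewrite /chr -(prim_order_dvd prim_z) -val_eqE /=.
have := ltn_ord x; rewrite [in X in (_ < X)%N]Zp_cast // => xN.
by case: (val x) xN => [|m] mN; rewrite ?dvdn0 // gtnNdvd.
Qed.

End Character.

Section CharacterSum.
Variables (F : numFieldType) (N : nat) (z : F).
Hypotheses (N_gt1 : (1 < N)%N) (prim_z : N.-primitive_root z).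
Variable V : finZmodType.

Lemma chr_sum_subgroup (K : {set V}) (f : V -> 'Z_N) : 0 \in K ->
  {in K &, forall x y, x - y \in K} -> {in K &, {morph f : x y / x + y}} ->
  \sum_(x in K) chr z (f x) = if [forall x in K, f x == 0] then #|K|%:R else 0.
Proof.
move=> K0 KB fD; case: ifP => [/forall_inP h|/negbT].
  rewrite (eq_bigr (fun=> 1)) => [|x /h /eqP ->]; first by rewrite sumr_const.
  by rewrite chr0.
rewrite negb_forall_in => /exists_inP[x0 x0K fx0].
have KN x : x \in K -> - x \in K by move=> xK; rewrite -sub0r KB.
have KD : {in K &, forall x y, x + y \in K}.
  by move=> x y xK yK; rewrite -[y]opprK KB // KN.
suff : (chr z (f x0) - 1) * \sum_(x in K) chr z (f x) = 0.
  by move/eqP; rewrite mulf_eq0 subr_eq0 chr_eq1 // (negPf fx0) => /eqP.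
rewrite mulrBl mul1r; apply/eqP; rewrite subr_eq0; apply/eqP.
rewrite [RHS](reindex (fun x => x0 + x)) /=; last first.
  by exists (fun x => - x0 + x) => x _; rewrite ?addKr ?addNKr.
rewrite mulr_sumr; apply: eq_big => [x|x xK].
  apply/idP/idP => [xK|x0xK]; first exact: KD.
  by rewrite -(addKr x0 x) KD // KN.
by rewrite fD // chrD.
Qed.

Variable B : V -> V -> 'Z_N.
Hypotheses (symB : forall x y, B x y = B y x).
Hypothesis BDl : forall x y t, B (x + y) t = B x t + B y t.

Let Bz : rel V := fun x y => B x y == 0.

Lemma B0l x : B 0 x = 0.
Proof. by apply: (addrI (B 0 x)); rewrite -BDl !addr0. Qed.

Lemma BNl x y : B (- x) y = - B x y.
Proof. by apply/eqP; rewrite -addr_eq0 -BDl addNr B0l. Qed.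

Lemma perp0 P : 0 \in perp Bz P.
Proof. by apply/perpP => p _; rewrite /Bz symB B0l. Qed.

Lemma perpB P : {in perp Bz P &, forall x y, x - y \in perp Bz P}.
Proof.
move=> x y /perpP xP /perpP yP; apply/perpP => p pP.
rewrite /Bz symB BDl BNl !(symB _ p).
by rewrite (eqP (xP p pP)) (eqP (yP p pP)) subr0.
Qed.

Lemma perpT_sub P : perp Bz finset.setT \subset perp Bz P.
Proof. by apply/fintype.subsetP => x /perpP h; apply/perpP => p _; exact: h. Qed.

(** Double counting of [chr z (B x y)] over [x] in the subgroup [K = perp P] and all [y]: the sum
    over [x] detects [y] in the perp of [K], the sum over [y] detects [x] in the radical, which lies
    in [K]. *)
Lemma card_perp_perp P :
  (#|perp Bz P| * #|perp Bz (perp Bz P)| = #|V| * #|perp Bz finset.setT|)%N.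
Proof.
set K := perp Bz P; apply/eqP; rewrite -(eqr_nat F) !natrM; apply/eqP.
have BD x : {morph B^~ x : y t / y + t} by move=> y t; exact: BDl.
transitivity (\sum_y \sum_(x in K) chr z (B x y)).
  rewrite (eq_bigr (fun y => if y \in perp Bz K then #|K|%:R else 0)) => [|y _].
    by rewrite -big_mkcond /= sumr_const mulr_natr.
  rewrite chr_sum_subgroup ?perp0 //; first by rewrite inE.
  exact: perpB.
rewrite exchange_big /=.
rewrite (eq_bigr (fun x => if x \in perp Bz finset.setT then #|V|%:R else 0)).
  rewrite -big_mkcondr /= sumr_const mulr_natr; congr (_ *+ _); apply: eq_card => x.
  by apply/andb_idl => h; apply: (fintype.subsetP (perpT_sub P)).
move=> x xK.
have -> : \sum_y chr z (B x y) = \sum_(y in [set: V]%SET) chr z (B y x).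
  by apply: eq_big => [y|y _]; rewrite ?inE // symB.
rewrite chr_sum_subgroup ?inE ?cardsT //.
by move=> y t _ _; rewrite inE.
Qed.

Variable D : nat.
Hypothesis D2 : (#|V| * #|perp Bz finset.setT| <= D ^ 2)%N.

(** [P] lies in its perp and in its double perp, so [#|P| ^ 2] is at most the product in
    [card_perp_perp]. *)
Lemma card_isotropic_le P : isotropic Bz P -> (#|P| <= D)%N.
Proof.
move=> /isotropicP iso.
have s1 : P \subset perp Bz P.
  by apply/fintype.subsetP => x xP; apply/perpP => p pP; exact: iso.
have s2 : P \subset perp Bz (perp Bz P).
  apply/fintype.subsetP => x xP; apply/perpP => p /perpP/(_ x xP).
  by rewrite /Bz symB.
have := leq_mul (subset_leq_card s1) (subset_leq_card s2).
by rewrite card_perp_perp => /leq_trans/(_ D2); rewrite leq_sqr.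
Qed.

(** Equality case: the double perp has at least [#|P|] elements, which leaves at most [#|P|] for the
    perp, and the perp contains [P]. *)
Lemma perp_lagrangian P : (0 < D)%N -> isotropic Bz P -> #|P| = D ->
  perp Bz P = P.
Proof.
move=> D0 /isotropicP iso PD.
have s1 : P \subset perp Bz P.
  by apply/fintype.subsetP => x xP; apply/perpP => p pP; exact: iso.
have s2 : P \subset perp Bz (perp Bz P).
  apply/fintype.subsetP => x xP; apply/perpP => p /perpP/(_ x xP).
  by rewrite /Bz symB.
apply/eqP; rewrite eq_sym eqEcard s1 /=.
have h1 := subset_leq_card s1; have h2 := subset_leq_card s2.
move: D2; rewrite -(card_perp_perp P) -PD expnS expn1 => h3.
have P0 : (0 < #|P|)%N by rewrite PD.
by rewrite -(leq_pmul2r P0); apply: leq_trans h3; rewrite leq_mul2l h2 orbT.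
Qed.

End CharacterSum.

(** * Counting in [Z/N] and in matrices over it *)

Section ZpKernel.
Variable N : nat.
Hypothesis N_gt1 : (1 < N)%N.

Lemma Zp_natr_eq0 k : ((k%:R : 'Z_N) == 0) = (N %| k)%N.
Proof. by rewrite Zp_nat -val_eqE /= Zp_cast. Qed.

Lemma Zp_quot_mul_eq0 m (x : 'Z_N) : (m %| N)%N ->
  ((N %/ m)%:R * x == 0) = (m %| x)%N.
Proof.
move=> mN; rewrite -{1}[x]natr_Zp -natrM Zp_natr_eq0.
have N0 : (0 < N)%N by exact: ltnW.
have -> : (N %| N %/ m * x)%N = (N %/ m * m %| N %/ m * x)%N by rewrite divnK.
rewrite dvdn_pmul2l // divn_gt0; last exact: dvdn_gt0 mN.
exact: dvdn_leq.
Qed.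

Lemma card_Zp_kernel m : (m %| N)%N ->
  #|[set x : 'Z_N | (N %/ m)%:R * x == 0]%SET| = (N %/ m)%N.
Proof.
move=> mN; have N0 : (0 < N)%N by exact: ltnW.
have m0 : (0 < m)%N := dvdn_gt0 N0 mN.
pose f (k : 'I_(N %/ m)) : 'Z_N := (m * k)%:R.
have fk k : f k = (m * k)%N :> nat.
  rewrite /f Zp_nat /= Zp_cast // modn_small //.
  by apply: leq_trans (_ : (m * (N %/ m) <= N)%N); rewrite ?ltn_pmul2l // mulnC divnK.
have finj : injective f.
  move=> k l e; apply/val_inj/eqP; rewrite -(eqn_pmul2l m0) -!fk e eqxx //.
rewrite -[RHS]card_ord -(card_imset _ finj); apply: eq_card => x.
rewrite inE Zp_quot_mul_eq0 //; apply/idP/imsetP => [mx|[k _ ->]]; last first.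
  by rewrite fk dvdn_mulr.
have xN : (x %/ m < N %/ m)%N.
  by rewrite ltn_divRL // divnK // -[X in (_ < X)%N](Zp_cast N_gt1) ltn_ord.
by exists (Ordinal xN) => //; apply/val_inj; rewrite /= fk /= mulnC divnK.
Qed.

End ZpKernel.

Lemma card_mx_box (T : finType) m n (S : 'I_m -> 'I_n -> {set T}) :
  #|[set M : 'M[T]_(m, n) | [forall i, forall j, M i j \in S i j]]%SET| =
  (\prod_i \prod_j #|S i j|)%N.
Proof.
rewrite pair_bigA /= -sum1_card.
under [RHS]eq_bigr do rewrite -sum1_card big_mkcond /=.
rewrite (bigA_distr_bigA (fun p x => if x \in S p.1 p.2 then 1%N else 0%N)) /=.
rewrite (reindex (fun f : {ffun 'I_m * 'I_n -> T} => \matrix_(i, j) f (i, j))) /=.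
  rewrite big_mkcond /=; apply: eq_bigr => f _; rewrite inE.
  case: ifP => [/forallP h|/negbT].
    by rewrite big1 // => -[i j] _ /=; have := forallP (h i) j; rewrite mxE => ->.
  rewrite negb_forall => /existsP[k]; rewrite negb_forall => /existsP[j].
  by rewrite mxE => /negPf h; rewrite (bigD1 (k, j)) //= h mul0n.
exists (fun M => [ffun p => M p.1 p.2]) => [f _|M _].
  by apply/ffunP => -[i j]; rewrite ffunE mxE.
by apply/matrixP => i j; rewrite mxE ffunE.
Qed.

(** Applied to the quadratic form on a graph, and to sums over a symmetric matrix, whose independent
    entries are those with [k <= l]. *)
Lemma sum_quadratic_fold (A : comPzRingType) r (x : 'I_r -> A) (w : 'I_r -> 'I_r -> A) :
  \sum_i \sum_j x i * x j * w i j =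
  \sum_i \sum_j x i * x j *
    (if (i < j)%N then w i j + w j i else if i == j then w i i else 0).
Proof.
pose L (i j : 'I_r) := if (i < j)%N then x i * x j * w i j else 0.
pose U (i j : 'I_r) := if (j < i)%N then x i * x j * w i j else 0.
pose E (i j : 'I_r) := if i == j then x i * x j * w i j else 0.
transitivity (\sum_i \sum_j (L i j + E i j) + \sum_i \sum_j U i j).
  rewrite -big_split /=; apply: eq_bigr => i _; rewrite -big_split /=.
  apply: eq_bigr => j _; rewrite /L /U /E -val_eqE /=.
  by case: ltngtP => _; rewrite ?addr0 ?add0r.
rewrite [X in _ + X]exchange_big -big_split /=; apply: eq_bigr => i _.
rewrite -big_split /=; apply: eq_bigr => j _; rewrite /L /U /E.
have [<-|ij] := eqVneq i j; first by rewrite ltnn addr0 add0r.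
by case: ifP => _; rewrite ?mulr0 ?addr0 // [x j * _]mulrC mulrDr.
Qed.

(** * The quadratic form, its radical and its Lagrangian subgroups *)

Section Form.
Variables (N r : nat) (a : 'I_r -> nat).
Hypotheses (N_gt1 : (1 < N)%N) (a_gt0 : forall i, (0 < a i)%N).
Hypothesis a2_dvd : forall i j, (a i * a j %| N)%N.

Notation A := 'Z_N.
Notation V := 'M['Z_N]_(2, r).
Implicit Types C d : 'M['Z_N]_r.

(** Multiplication by [nu i] turns a congruence modulo [a i] into an equation in [Z/N]. *)
Definition nu i : A := (N %/ a i)%:R.
(* The pairing conditions are only imposed for [i <= j]. *)
Definition nu2 (i j : 'I_r) : A := if (i <= j)%N then (N %/ (a i * a j))%:R else 0.

(** Row [0] is a lift of an element of [G], row [1] is the dual vector of a matrix column.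
    [beta d (y k) (y l)] is the coefficient of the entry [(k, l)] in the phase. *)
Definition beta (d : 'M[A]_r) (y y' : V) : A :=
  \sum_i nu i * y 0 i * y' 1 i +
  \sum_i \sum_j nu2 i j * d i j * y 0 i * y' 0 j.
Definition qf d y := beta d y y.
Definition bf d y y' := beta d y y' + beta d y' y.

Definition bz d : rel V := fun x y => bf d x y == 0.
Definition qz d : pred V := fun x => qf d x == 0.

(** Order of the kernel of [(Z/N)^r -> G], hence the number of lifts of an element of [G]. *)
Definition ker_card := (\prod_i (N %/ a i))%N.
Definition lag_card := (N ^ r * ker_card)%N.

Lemma a_dvd i : (a i %| N)%N.
Proof. exact: dvdn_trans (dvdn_mulr _ (dvdnn _)) (a2_dvd i i). Qed.

Lemma nu2_al (i j : 'I_r) : (i <= j)%N -> nu2 i j * (a i)%:R = nu j.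
Proof.
move=> ij; rewrite /nu2 ij -natrM /nu; congr _%:R.
by rewrite [(a i * a j)%N]mulnC divnMA divnK // dvdn_divRL ?a_dvd.
Qed.

Lemma nu2_ar (i j : 'I_r) : (i <= j)%N -> nu2 i j * (a j)%:R = nu i.
Proof.
move=> ij; rewrite /nu2 ij -natrM /nu; congr _%:R.
by rewrite divnMA divnK // dvdn_divRL ?a_dvd // mulnC.
Qed.

Lemma nu2_gt (i j : 'I_r) : (j < i)%N -> nu2 i j = 0.
Proof. by move=> ji; rewrite /nu2 leqNgt ji. Qed.

Lemma betaDl d (x y t : V) : beta d (x + y) t = beta d x t + beta d y t.
Proof.
rewrite /beta addrACA; congr (_ + _); rewrite -big_split /=; apply: eq_bigr => i _.
  by rewrite mxE mulrDr mulrDl.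
by rewrite -big_split /=; apply: eq_bigr => j _; rewrite mxE mulrDr mulrDl.
Qed.

Lemma betaDr d (x y t : V) : beta d t (x + y) = beta d t x + beta d t y.
Proof.
rewrite /beta addrACA; congr (_ + _); rewrite -big_split /=; apply: eq_bigr => i _.
  by rewrite mxE mulrDr.
by rewrite -big_split /=; apply: eq_bigr => j _; rewrite mxE mulrDr.
Qed.

Lemma bfC d x y : bf d x y = bf d y x.
Proof. by rewrite /bf addrC. Qed.

Lemma bfDl d (x y t : V) : bf d (x + y) t = bf d x t + bf d y t.
Proof. by rewrite /bf betaDl betaDr addrACA. Qed.

Lemma qfD d (x y : V) : qf d (x + y) = qf d x + qf d y + bf d x y.
Proof. by rewrite /qf /bf betaDl !betaDr; ring. Qed.

Lemma card_nu_kernel i : #|[set x : A | nu i * x == 0]%SET| = (N %/ a i)%N.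
Proof. by rewrite card_Zp_kernel // a_dvd. Qed.

Definition pairV (X c : 'I_r -> A) : V := \matrix_(k < 2, i < r) if k == 0 then X i else c i.

Lemma pairV0 X c i : pairV X c 0 i = X i. Proof. by rewrite mxE. Qed.
Lemma pairV1 X c i : pairV X c 1 i = c i. Proof. by rewrite mxE. Qed.

Lemma matrix2P (y y' : V) :
  (forall i, y 0 i = y' 0 i) -> (forall i, y 1 i = y' 1 i) -> y = y'.
Proof.
move=> h0 h1; apply/matrixP => k i; have [->//|] := eqVneq k 0.
by case: k => -[|[|//]] //= hk _; rewrite (_ : Ordinal hk = 1) //; apply: val_inj.
Qed.

(* [(X, rad_part d X)] lies in the radical of [bf d] when [nu i * X i = 0]. *)
Definition rad_part (d : 'M[A]_r) (y : V) (j : 'I_r) : A :=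
  - \sum_(i < r) ((if (i <= j)%N then d i j else 0) + (if (j <= i)%N then d j i else 0)) *
     (y 0 i %/ a i)%:R.

(** The hypothesis makes [y 0 i] a multiple of [a i], and this factor turns [nu2] into [nu]. What
    remains depends on [y'] through its first row only. *)
Lemma bf_kernel d (y y' : V) : (forall i, nu i * y 0 i = 0) ->
  bf d y y' = \sum_j y' 0 j * (nu j * (y 1 j - rad_part d y j)).
Proof.
move=> y0; pose t i : A := (y 0 i %/ a i)%:R.
have yt i : y 0 i = t i * (a i)%:R.
  rewrite /t -natrM divnK ?natr_Zp // -(Zp_quot_mul_eq0 N_gt1) ?a_dvd //.
  by apply/eqP; exact: y0.
rewrite /bf /beta big1 ?add0r => [|i _]; last by rewrite y0 mul0r.
under [X in _ = X]eq_bigr => j _.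
  rewrite /rad_part opprK mulrDr mulrDr mulr_sumr mulr_sumr; over.
rewrite big_split /= addrCA; congr (_ + _).
  by apply: eq_bigr => j _; ring.
rewrite [X in X + _]exchange_big -big_split /=; apply: eq_bigr => j _.
rewrite -big_split /=; apply: eq_bigr => i _; rewrite -/(t i) mulrDl !mulrDr.
congr (_ + _).
  case: leqP => ij; last by rewrite nu2_gt // !(mul0r, mulr0).
  by rewrite yt -(nu2_al ij); ring.
case: leqP => ij; last by rewrite nu2_gt // !(mul0r, mulr0).
by rewrite yt -(nu2_ar ij); ring.
Qed.

Lemma bf_pair1 d (y : V) i : bf d y (pairV (fun=> 0) (fun j => (j == i)%:R)) = nu i * y 0 i.
Proof.
rewrite /bf /beta [in X in _ + X]big1 ?[in X in _ + (_ + X)]big1 ?addr0; last first.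
- by move=> k _; rewrite pairV0 mulr0 mul0r.
- by move=> k _; rewrite big1 // => l _; rewrite pairV0 mulr0 mul0r.
rewrite (bigD1 i) //= pairV1 eqxx mulr1 big1 => [|k /negPf ki]; last first.
  by rewrite pairV1 ki mulr0.
by rewrite big1 ?addr0 // => k _; rewrite big1 // => l _; rewrite pairV0 mulr0.
Qed.

Lemma perpT_bz d (y : V) : (y \in perp (bz d) finset.setT) =
  [forall i, nu i * y 0 i == 0] && [forall j, nu j * (y 1 j - rad_part d y j) == 0].
Proof.
apply/perpP/andP => [h|[/forallP h0 /forallP h1] x _].
  have h0 i : nu i * y 0 i = 0.
    apply/eqP; rewrite -(bf_pair1 d) bfC; exact: h.
  split; first by apply/forallP => i; apply/eqP.
  apply/forallP => j; have := h (pairV (fun i => (i == j)%:R) (fun=> 0)) (finset.in_setT _).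
  rewrite /bz bfC bf_kernel // (bigD1 j) //= pairV0 eqxx mul1r big1 ?addr0 //.
  by move=> i /negPf ij; rewrite pairV0 ij mul0r.
rewrite /bz bfC bf_kernel => [|i]; last exact/eqP.
by rewrite big1 // => j _; rewrite (eqP (h1 j)) mulr0.
Qed.

Lemma card_V : #|{: V}| = (N ^ (2 * r))%N.
Proof. by rewrite card_mx card_ord Zp_cast. Qed.

(** The shear [(X, c) -> (X, c - rad_part d X)] is injective and carries the radical into the
    matrices with both rows in the kernel of [(Z/N)^r -> G]. *)
Lemma card_radical d : (#|{: V}| * #|perp (bz d) finset.setT| <= lag_card ^ 2)%N.
Proof.
rewrite card_V /lag_card expnMn -expnM [(r * 2)%N]mulnC leq_mul2l; apply/orP; right.
pose g (y : V) := pairV (y 0) (fun j => y 1 j - rad_part d y j).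
have ginj : injective g.
  move=> x y e; have e0 i : x 0 i = y 0 i.
    by have := congr1 (fun M : V => M 0 i) e; rewrite /g !pairV0.
  apply: matrix2P => // i; have := congr1 (fun M : V => M 1 i) e.
  rewrite /g !pairV1 (_ : rad_part d x i = rad_part d y i); first exact: addIr.
  by rewrite /rad_part; congr (- _); apply: eq_bigr => j _; rewrite e0.
pose S (k : 'I_2) i := [set x : A | nu i * x == 0]%SET.
have <- : #|[set M : V | [forall k, forall i, M k i \in S k i]]%SET| = (ker_card ^ 2)%N.
  rewrite card_mx_box big_ord_recl big_ord1 /ker_card expnS expn1.
  by congr (_ * _)%N; apply: eq_bigr => i _; rewrite card_nu_kernel.
rewrite -[leqRHS](card_preimset _ ginj); apply/subset_leq_card/fintype.subsetP => y.
rewrite perpT_bz !inE => /andP[/forallP h0 /forallP h1].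
apply/forallP => k; apply/forallP => i; rewrite /S inE /g mxE.
by case: (k == 0).
Qed.

(** The second row is fixed only modulo the [a j]; this saturation by the kernel gives the graph its
    order [lag_card]. *)
Definition graph (C : 'M[A]_r) : {set V} :=
  [set y : V | [forall j, nu j * (y 1 j - \sum_i y 0 i * C i j) == 0]]%SET.

Definition onto (H : {set V}) :=
  [forall X : 'rV[A]_r, exists y in H, forall k, nu k * (y 0 k - X 0 k) == 0].

(** Coefficient of [X i * X j] in [\sum_i nu i * X i * c i] with [c = X C], folded to upper
    triangular form. [compatible] cancels it against the part of [qf d] that involves [d]. *)
Definition cross (C : 'M[A]_r) (i j : 'I_r) : A :=
  if (i < j)%N then nu j * C i j + nu i * C j i
  else if i == j then nu i * C i i else 0.

Definition compatible (C d : 'M[A]_r) :=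
  [forall i, forall j, nu2 i j * d i j == - cross C i j].

Definition graph_point (C : 'M[A]_r) (X : 'I_r -> A) : V :=
  pairV X (fun j => \sum_i X i * C i j).

Lemma graphP C (y : V) :
  reflect (forall j, nu j * y 1 j = nu j * \sum_i y 0 i * C i j) (y \in graph C).
Proof.
rewrite inE; apply: (iffP forallP) => h j; have := h j.
  by rewrite mulrBr subr_eq0 => /eqP.
by move=> e; rewrite mulrBr subr_eq0; apply/eqP.
Qed.

Lemma graph_pointP C X : graph_point C X \in graph C.
Proof.
apply/graphP => j; rewrite pairV1; congr (_ * _).
by apply: eq_bigr => i _; rewrite pairV0.
Qed.

Lemma card_graph C : #|graph C| = lag_card.
Proof.
pose g (y : V) := pairV (y 0) (fun j => y 1 j - \sum_i y 0 i * C i j).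
have ginj : injective g.
  move=> x y e; have e0 i : x 0 i = y 0 i.
    by have := congr1 (fun M : V => M 0 i) e; rewrite /g !pairV0.
  apply: matrix2P => // i; have := congr1 (fun M : V => M 1 i) e; rewrite /g !pairV1.
  rewrite (eq_bigr (fun k => y 0 k * C k i)) => [|k _]; last by rewrite e0.
  exact: addIr.
pose S (k : 'I_2) i := if k == 0 then finset.setT else [set x : A | nu i * x == 0]%SET.
have <- : #|[set M : V | [forall k, forall i, M k i \in S k i]]%SET| = lag_card.
  rewrite card_mx_box big_ord_recl big_ord1 /lag_card /ker_card; congr (_ * _)%N.
    rewrite (eq_bigr (fun=> N)) => [|i _]; first by rewrite prod_nat_const card_ord.
    by rewrite /S /= cardsT card_ord Zp_cast.
  by apply: eq_bigr => i _; rewrite card_nu_kernel.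
rewrite -[RHS](card_preimset _ ginj); apply: eq_card => y; rewrite !inE.
apply/forallP/forallP => [h k|h j]; last first.
  by have := forallP (h 1) j; rewrite /S /= inE /g pairV1.
by apply/forallP => i; rewrite /S /g mxE; case: (k == 0); rewrite ?inE //; exact: h.
Qed.

Lemma graph_add C : {in graph C &, forall x y, x + y \in graph C}.
Proof.
move=> x y /graphP hx /graphP hy; apply/graphP => j.
rewrite mxE mulrDr hx hy -mulrDr -big_split /=; congr (_ * _).
by apply: eq_bigr => i _; rewrite mxE mulrDl.
Qed.

Lemma qf_graph C d y : compatible C d -> y \in graph C -> qf d y = 0.
Proof.
move=> /forallP comp /graphP h; rewrite /qf /beta.
have -> : \sum_i nu i * y 0 i * y 1 i =
    \sum_i \sum_j y 0 i * y 0 j * (nu j * C i j).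
  rewrite exchange_big /=; apply: eq_bigr => j _.
  by rewrite mulrAC h -mulrA mulr_suml mulr_sumr; apply: eq_bigr => i _; ring.
rewrite sum_quadratic_fold -big_split big1 //= => i _.
rewrite -big_split big1 //= => j _.
have /forallP/(_ j)/eqP := comp i; rewrite /cross -!mulrA => e.
by rewrite [nu2 i j * _]mulrA e mulNr mulrA [X in _ - X]mulrC subrr.
Qed.

Lemma lagrangian_graph C d : compatible C d ->
  lagrangian (bz d) (qz d) lag_card (graph C).
Proof.
move=> comp; rewrite /lagrangian card_graph eqxx /=; apply/andP; split.
  apply/isotropicP => x y xC yC; rewrite /bz.
  have := qf_graph comp (graph_add xC yC); rewrite qfD !(qf_graph comp) //.
  by rewrite !add0r => ->.
by apply/forall_inP => x xC; rewrite /qz (qf_graph comp xC).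
Qed.

Lemma onto_graph C : onto (graph C).
Proof.
apply/forallP => X; apply/exists_inP; exists (graph_point C (X 0)).
  exact: graph_pointP.
by apply/forallP => k; rewrite pairV0 subrr mulr0.
Qed.

Lemma beta_graph_point C d i j :
  beta d (graph_point C (fun k => (k == i)%:R)) (graph_point C (fun k => (k == j)%:R)) =
  nu i * C j i + nu2 i j * d i j.
Proof.
rewrite /beta; congr (_ + _).
  rewrite (bigD1 i) //= [X in _ + X]big1 ?addr0 => [|k /negPf ki]; last first.
    by rewrite pairV0 ki mulr0 mul0r.
  rewrite pairV0 pairV1 eqxx mulr1; congr (_ * _).
  by rewrite (bigD1 j) //= eqxx mul1r big1 ?addr0 // => k /negPf ->; exact: mul0r.
rewrite (bigD1 i) //= [X in _ + X]big1 ?addr0 => [|k /negPf ki]; last first.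
  by rewrite big1 // => l _; rewrite pairV0 ki mulr0 mul0r.
rewrite (bigD1 j) //= big1 ?addr0 => [|k /negPf kj]; last by rewrite !pairV0 kj mulr0.
by rewrite !pairV0 !eqxx !mulr1.
Qed.

(** At the graph points over the unit vectors, the polar form gives the conditions for [i < j] and
    the quadratic form those for [i = j]. *)
Lemma lagrangian_compatible C d : lagrangian (bz d) (qz d) lag_card (graph C) ->
  compatible C d.
Proof.
move=> /and3P[/isotropicP iso _ /forall_inP hq].
apply/forallP => i; apply/forallP => j; rewrite /cross -addr_eq0.
case: ltngtP => ij.
- have := iso _ _ (graph_pointP C (fun l => (l == i)%:R)) (graph_pointP C (fun l => (l == j)%:R)).
  rewrite /bz /bf !beta_graph_point (nu2_gt ij) mul0r addr0 => /eqP e0.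
  by apply/eqP; rewrite -[RHS]e0; ring.
- have -> : (i == j) = false by rewrite -val_eqE /= gtn_eqF.
  by rewrite (nu2_gt ij) mul0r add0r.
have {ij} <- : i = j by exact: val_inj.
rewrite eqxx; have := hq _ (graph_pointP C (fun l => (l == i)%:R)).
by rewrite /qz /qf beta_graph_point addrC.
Qed.

Lemma graph_eq C C' : (graph C == graph C') =
  [forall i, forall j, nu j * (C i j - C' i j) == 0].
Proof.
apply/eqP/forallP => [e i|h].
  apply/forallP => j; have := graph_pointP C (fun l => (l == i)%:R); rewrite e.
  move=> /graphP/(_ j); rewrite pairV1 mulrBr subr_eq0.
  rewrite (bigD1 i) //= eqxx mul1r big1 ?addr0 => [->|k /negPf ->]; last exact: mul0r.
  rewrite (bigD1 i) //= pairV0 eqxx mul1r big1 ?addr0 // => k /negPf ki.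
  by rewrite pairV0 ki mul0r.
apply/setP => y; apply/graphP/graphP => hy j; rewrite hy !mulr_sumr; apply: eq_bigr => i _.
  have /forallP/(_ j) := h i; rewrite mulrBr subr_eq0 => /eqP e.
  by rewrite mulrCA e mulrCA.
have /forallP/(_ j) := h i; rewrite mulrBr subr_eq0 => /eqP e.
by rewrite mulrCA -e mulrCA.
Qed.

Lemma lag_card_gt0 : (0 < lag_card)%N.
Proof.
have N0 : (0 < N)%N by exact: ltnW.
rewrite /lag_card muln_gt0 expn_gt0 N0 /=; apply: prodn_gt0 => i.
by rewrite divn_gt0 //; exact: dvdn_leq N0 (a_dvd i).
Qed.

Lemma ker_card_mul : (ker_card * \prod_i a i = N ^ r)%N.
Proof.
rewrite -big_split /= (eq_bigr (fun=> N)) => [|i _]; last by rewrite divnK ?a_dvd.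
by rewrite prod_nat_const card_ord.
Qed.

(** The index [i] occurs once in each of the [r - 1] pairs with another index and twice in
    [(i, i)]. *)
Lemma prod_upper_pairs :
  (\prod_(i < r) \prod_(j < r) (if i <= j then a i * a j else 1) = (\prod_i a i) ^ r.+1)%N.
Proof.
pose U (i j : 'I_r) := if (i <= j)%N then a i else 1%N.
pose W (i j : 'I_r) := if (j <= i)%N then a i else 1%N.
transitivity (\prod_i \prod_j U i j * \prod_i \prod_j W j i)%N.
  rewrite -big_split /=; apply: eq_bigr => i _; rewrite -big_split /=.
  by apply: eq_bigr => j _; rewrite /U /W; case: leqP.
rewrite [X in (_ * X)%N]exchange_big -big_split /= expnSr.
rewrite (big_morph (expn^~ r) (fun m n => expnMn m n r) (exp1n r)) -big_split /=.
apply: eq_bigr => i _; rewrite -big_split /=.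
rewrite (eq_bigr (fun j => a i * (if j == i then a i else 1))%N) => [|j _]; last first.
  by rewrite /U /W -val_eqE /=; case: ltngtP => _; rewrite ?mul1n ?muln1.
by rewrite big_split /= prod_nat_const card_ord -big_mkcond big_pred1_eq.
Qed.

Lemma card_nu2_fibre (i j : 'I_r) (w : A) :
  #|[set x : A | nu2 i j * x == nu2 i j * w]%SET| =
  (if i <= j then N %/ (a i * a j) else N)%N.
Proof.
have inj : injective (fun x : A => x - w) by move=> x y; exact: addIr.
rewrite -(eq_card (_ : (fun x => x - w) @^-1: [set x : A | nu2 i j * x == 0]%SET =i _)).
  rewrite card_preimset //; rewrite /nu2; case: leqP => ij.
    by rewrite card_Zp_kernel.
  rewrite -[RHS](Zp_cast N_gt1) -[RHS]card_ord -cardsT; apply: eq_card => x.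
  by rewrite !inE mul0r eqxx.
by move=> x; rewrite !inE mulrBr subr_eq0.
Qed.

(** [cross C i j] is a multiple of [nu2 i j], so each entry of [d] has a particular solution, given
    by [w], and the entries are constrained independently. Below the diagonal they are free. *)
Lemma card_compatible_right C :
  (#|[set d : 'M[A]_r | compatible C d]%SET| * (\prod_i a i) ^ r.+1 = N ^ (r * r))%N.
Proof.
pose w (i j : 'I_r) : A := if (i < j)%N then - ((a i)%:R * C i j + (a j)%:R * C j i)
  else - ((a i)%:R * C i i).
have cw i j : - cross C i j = nu2 i j * w i j.
  rewrite /cross /w; case: ltngtP => ij.
  - by rewrite -(nu2_al (ltnW ij)) -(nu2_ar (ltnW ij)); ring.
  - have -> : (i == j) = false by rewrite -val_eqE /= gtn_eqF.
    by rewrite (nu2_gt ij) mul0r oppr0.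
  have {ij} <- : i = j by exact: val_inj.
  by rewrite eqxx -(nu2_al (leqnn i)); ring.
rewrite (eq_card (_ : _ =i [set d : 'M[A]_r | [forall i, forall j,
    d i j \in [set x : A | nu2 i j * x == nu2 i j * w i j]]]%SET)); last first.
  move=> d; rewrite !inE; apply: eq_forallb => i; apply: eq_forallb => j.
  by rewrite inE cw.
rewrite card_mx_box -prod_upper_pairs -big_split /= expnM.
rewrite -[RHS](_ : \prod_(i < r) N ^ r = _)%N; last by rewrite prod_nat_const card_ord.
apply: eq_bigr => i _; rewrite -big_split /=.
rewrite (eq_bigr (fun=> N)) => [|j _]; first by rewrite prod_nat_const card_ord.
by rewrite card_nu2_fibre; case: leqP => _; rewrite ?muln1 ?divnK.
Qed.

Variables (F : numFieldType) (z : F).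
Hypothesis prim_z : N.-primitive_root z.

Lemma lagrangian_perp d H : lagrangian (bz d) (qz d) lag_card H ->
  perp (bz d) H = H.
Proof.
move=> /and3P[iso /eqP cardH _].
exact: (perp_lagrangian N_gt1 prim_z (bfC d) (bfDl d) (card_radical d) lag_card_gt0).
Qed.

(** [lagrangian] is a condition on sets; equality with its own perp makes [H] a subgroup. *)
Lemma lagrangian_subgroup d H : lagrangian (bz d) (qz d) lag_card H ->
  (0 \in H) /\ {in H &, forall x y, x - y \in H}.
Proof.
move=> /lagrangian_perp <-; split; first exact: perp0 (bfC d) (bfDl d) _.
exact: perpB (bfC d) (bfDl d) _.
Qed.

(** [H] has points over the unit vectors modulo the [a k]; radical vectors, which lie in [H],
    correct them to exact ones, whose second rows form [C]. These points and the radical generate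
    the graph, so it lies in [H], and the orders agree. *)
Lemma lagrangian_onto_graph d H : lagrangian (bz d) (qz d) lag_card H -> onto H ->
  exists C, H = graph C.
Proof.
move=> lagH /forallP ontoH; have [H0 HB] := lagrangian_subgroup lagH.
have HN x : x \in H -> - x \in H by move=> xH; rewrite -sub0r HB.
have HD : {in H &, forall x y, x + y \in H}.
  by move=> x y xH yH; rewrite -[y]opprK HB // HN.
have HM x m : x \in H -> x *+ m \in H.
  by move=> xH; elim: m => [|m IH]; rewrite ?mulr0n // mulrS HD.
have radH v : v \in perp (bz d) finset.setT -> v \in H.
  by rewrite -(lagrangian_perp lagH); exact: (fintype.subsetP (perpT_sub _ _)).
have pt i : exists c : {ffun 'I_r -> A}, pairV (fun k => (k == i)%:R) c \in H.
  have /exists_inP[y yH /forallP yi] := ontoH (\row_k (k == i)%:R).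
  pose X k := y 0 k - (k == i)%:R.
  (* Every [nu k] kills [X], so this second row puts [v] in the radical. The argument [pairV X X] is
     a filler: [rad_part] reads only the first row. *)
  pose v := pairV X (rad_part d (pairV X X)).
  have vH : v \in H.
    apply: radH; rewrite perpT_bz; apply/andP; split; apply/forallP => k.
      by rewrite pairV0 /X; have := yi k; rewrite mxE.
    rewrite pairV1 /rad_part; under eq_bigr do rewrite pairV0.
    by under [in X in _ - X]eq_bigr do rewrite pairV0; rewrite subrr mulr0.
  exists [ffun k => (y - v) 1 k]; rewrite (_ : pairV _ _ = y - v) ?HB //.
  apply: matrix2P => k; rewrite ?pairV0 ?pairV1 ?ffunE //.
  by rewrite !mxE /X subKr.
have {pt} [c cH] := fin_all_exists pt.
pose C := \matrix_(i, j) c i j; exists C.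
apply/eqP; rewrite eq_sym eqEcard card_graph.
have /and3P[_ /eqP -> _] := lagH; rewrite leqnn andbT.
apply/fintype.subsetP => y /graphP yC.
pose v := pairV (fun=> 0) (fun j => y 1 j - \sum_i y 0 i * C i j).
have -> : y = \sum_i pairV (fun k => (k == i)%:R) (c i) *+ y 0 i + v.
  apply: matrix2P => j; rewrite mxE summxE ?pairV0 ?pairV1.
    rewrite (bigD1 j) //= mulmxnE pairV0 eqxx natr_Zp big1 ?addr0 // => i /negPf ij.
    by rewrite mulmxnE pairV0 eq_sym ij mul0rn.
  rewrite (eq_bigr (fun i => y 0 i * C i j)) ?subrKC // => i _.
  by rewrite mulmxnE pairV1 mxE -mulr_natl natr_Zp.
apply: (HD); first by apply: (big_ind (fun u : V => u \in H)) => [//|u w uH wH|i _]; [exact: HD|exact: HM].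
apply: radH; rewrite perpT_bz; apply/andP; split; apply/forallP => k.
  by rewrite pairV0 mulr0.
have -> : rad_part d v k = 0.
  by rewrite /rad_part big1 ?oppr0 // => i _; rewrite pairV0 /= div0n mulr0.
by rewrite pairV1 subr0 mulrBr yC subrr.
Qed.

Definition lag_onto d : {set {set V}} :=
  [set H | lagrangian (bz d) (qz d) lag_card H && onto H]%SET.

(** [H] is the graph of [C0 + E] exactly for the [ker_card ^ r] matrices [E] with
    [nu j * E i j = 0]. All of them are compatible, since being Lagrangian depends only on the
    graph. *)
Lemma card_compatible_left d :
  (#|lag_onto d| * ker_card ^ r = #|[set C : 'M[A]_r | compatible C d]%SET|)%N.
Proof.
rewrite -[RHS]sum1_card (partition_big graph [in lag_onto d]) /=; last first.
  by move=> C; rewrite !inE => /lagrangian_graph -> /=; exact: onto_graph.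
rewrite -sum_nat_const; apply: eq_bigr => H; rewrite inE => /andP[lagH ontoH].
have [C0 HE] := lagrangian_onto_graph lagH ontoH.
have inj : injective (fun C : 'M[A]_r => C - C0) by move=> x y; exact: addIr.
rewrite sum1_card.
have -> : (ker_card ^ r)%N = #|[set C : 'M[A]_r | [forall i, forall j,
    C i j \in [set x : A | nu j * x == 0]]]%SET|.
  rewrite card_mx_box (eq_bigr (fun=> ker_card)) => [|i _]; last first.
    by apply: eq_bigr => j _; rewrite card_nu_kernel.
  by rewrite prod_nat_const card_ord.
rewrite -[LHS](card_preimset _ inj); apply: eq_card => C.
rewrite [in RHS]unfold_in !inE /= HE graph_eq.
transitivity [forall i, forall j, nu j * (C i j - C0 i j) == 0].
  by apply: eq_forallb => i; apply: eq_forallb => j; rewrite inE !mxE.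
apply/idP/andP => [h|[]//]; split=> //; apply: lagrangian_compatible.
by have := h; rewrite -graph_eq => /eqP ->; rewrite -HE.
Qed.

(** Compatible pairs [(C, d)] are counted from both sides. On such a pair [nu2 i j * d i j] is a
    combination of [nu i] and [nu j], which kill [Q i j]; the phase is then [1] and [Q] drops
    out. *)
Lemma sum_lag_onto (Q : 'I_r -> 'I_r -> A) :
  (forall i j, nu i * Q i j = 0) -> (forall i j, nu j * Q i j = 0) ->
  \sum_(d : 'M[A]_r) chr z (- \sum_i \sum_j nu2 i j * d i j * Q i j) * #|lag_onto d|%:R =
  (N ^ (r * r))%:R / (\prod_i a i)%:R :> F.
Proof.
move=> Ql Qr; set aa := (\prod_i a i)%N.
have aa0 : aa%:R != 0 :> F by rewrite pnatr_eq0 -lt0n prodn_gt0.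
have chr1 C d : compatible C d -> chr z (- \sum_i \sum_j nu2 i j * d i j * Q i j) = 1.
  move=> /forallP comp; rewrite big1 ?oppr0 ?chr0 // => i _; rewrite big1 // => j _.
  have /forallP/(_ j)/eqP -> := comp i; rewrite /cross.
  case: ifP => _; last by case: ifP => _; rewrite ?oppr0 ?mul0r // mulNr mulrAC Ql mul0r oppr0.
  by rewrite mulNr mulrDl mulrAC Qr mul0r mulrAC Ql mul0r addr0 oppr0.
have k0 : (ker_card ^ r)%:R != 0 :> F.
  have := lag_card_gt0; rewrite /lag_card muln_gt0 => /andP[_ kc].
  by rewrite pnatr_eq0 -lt0n expn_gt0 kc.
apply: (mulIf k0); rewrite mulr_suml.
transitivity (\sum_(d : 'M[A]_r) \sum_(C : 'M[A]_r | compatible C d) (1 : F)).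
  apply: eq_bigr => d _; rewrite -mulrA -natrM card_compatible_left.
  rewrite -sum1_card natr_sum mulr_sumr; apply: eq_big => C; rewrite inE // => comp.
  by rewrite (chr1 C) // mulr1.
under eq_bigr do rewrite big_mkcond /=.
rewrite exchange_big /=.
have aar0 : (aa ^ r.+1)%:R != 0 :> F by rewrite natrX expf_neq0.
apply: (mulIf aar0); rewrite mulr_suml.
transitivity (\sum_(C : 'M[A]_r) (N ^ (r * r))%:R : F).
  apply: eq_bigr => C _; rewrite -big_mkcond /= -(card_compatible_right C) natrM.
  by congr (_ * _); rewrite sumr_const; congr (_%:R); apply: eq_card => d; rewrite inE.
rewrite sumr_const card_mx card_ord Zp_cast // -[LHS]mulr_natl.
rewrite expnSr natrM -/aa; apply/eqP.
have -> : (N ^ (r * r))%:R / aa%:R * (ker_card ^ r)%:R * ((aa ^ r)%:R * aa%:R) =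
   (N ^ (r * r))%:R * ((ker_card ^ r)%:R * (aa ^ r)%:R) :> F by field.
by rewrite -[(ker_card ^ r)%:R * _]natrM -expnMn ker_card_mul -expnM.
Qed.

End Form.

Lemma closed_prim_root_exists (F : numClosedFieldType) n : (0 < n)%N ->
  exists z : F, n.-primitive_root z.
Proof.
pose p : {poly F} := 'X^n - 1; have [r Dp] := closed_field_poly_normal p.
move=> n_gt0; rewrite (monicP _) ?monicXnsubC // scale1r in Dp.
have rn1 : all n.-unity_root r by apply/allP=> z; rewrite -root_prod_XsubC -Dp.
have sz_r : (n < (size r).+1)%N.
  by rewrite -(size_prod_XsubC r id) -Dp size_XnsubC.
have [|z] := hasP (has_prim_root n_gt0 rn1 _ sz_r); last by exists z.
by rewrite -separable_prod_XsubC -Dp separable_Xn_sub_1 // pnatr_eq0 -lt0n.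
Qed.

Lemma finite_pos_lower_bound (R : realType) (T : finType) (P : pred T) (f : T -> R) :
  (forall x, P x -> 0 < f x) -> exists2 k, 0 < k <= 1 & forall x, P x -> k <= f x.
Proof.
move=> f0; pose s := \sum_(x | P x) (f x)^-1.
have s0 : 0 <= s by apply: sumr_ge0 => x /f0 fx; rewrite invr_ge0 ltW.
exists (1 + s)^-1.
  have h : 0 < 1 + s by lra.
  by rewrite invr_gt0 h /= invf_le1 //; lra.
move=> x Px; have fx := f0 x Px.
rewrite -[leRHS]invrK lef_pV2 ?posrE ?invr_gt0 //; last by lra.
rewrite /s (bigD1 x) //=; have : 0 <= \sum_(i | P i && (i != x)) (f i)^-1.
  by apply: sumr_ge0 => i /andP[/f0 fi _]; rewrite invr_ge0 ltW.
lra.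
Qed.

(** * Fourier coefficients of a balanced law *)

Section FourierBound.
Local Open Scope complex_scope.
Variables (R : realType) (N : nat) (z : R[i]).
Hypotheses (N_gt1 : (1 < N)%N) (prim_z : N.-primitive_root z).
Notation A := 'Z_N.

Lemma norm_chr (x : A) : `|chr z x| = 1.
Proof.
have z1 : `|z| = 1.
  have : `|z| ^+ N = 1 by rewrite -normrX (prim_expr_order prim_z) normr1.
  by move/eqP; rewrite pexpr_eq1 // ?(ltnW N_gt1) // => /eqP.
by rewrite /chr normrX z1 expr1n.
Qed.

Lemma chr_conj (x : A) : conjc (chr z x) = chr z (- x).
Proof.
have e : chr z x * conjc (chr z x) = 1 by rewrite -sqr_normc norm_chr expr1n.
have x0 : chr z x != 0 by rewrite -normr_eq0 norm_chr oner_eq0.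
by apply: (mulfI x0); rewrite e -chrD // subrr chr0.
Qed.

Lemma Re_chr_lt1 (x : A) : x != 0 -> complex.Re (chr z x) < 1.
Proof.
rewrite -(chr_eq1 N_gt1 prim_z) => x1; have := add_Re2_Im2 (chr z x).
rewrite norm_chr expr1n => /complexI; case: (chr z x) x1 => u v /=.
rewrite eq_complex /= negb_and => uv e; rewrite ltNge; apply/negP => u1.
have v0 : v = 0 by apply/eqP; rewrite -sqrf_eq0; apply/eqP; nra.
have : u = 1 by subst v; nra.
by move=> e1; move: uv; rewrite v0 e1 !eqxx.
Qed.

Definition fourier (mu : A -> R) (t : A) : R[i] := \sum_s (mu s)%:C * chr z (t * s).

Lemma fourier0 mu : \sum_s mu s = 1 -> fourier mu 0 = 1.
Proof.
move=> mu1; rewrite /fourier; under eq_bigr do rewrite mul0r chr0 mulr1.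
by rewrite -rmorph_sum mu1.
Qed.

(** The squared modulus is the mean of [Re (chr z (t * s - t * s'))] over two independent draws. For
    each [s] the argument is non-zero with probability at least [alpha], and there the real part is
    at most [1 - kap]. The result [1 - kap * alpha] is at most [(1 - kap * alpha / 2) ^ 2]. *)
Lemma fourier_bound (alpha : R) : 0 < alpha -> alpha < 1 ->
  exists rho : R, [/\ 0 <= rho, rho < 1 & forall (mu : A -> R) (t : A),
    (forall s, 0 <= mu s) -> \sum_s mu s = 1 -> t != 0 ->
    (forall s, \sum_(s' | t * s' == t * s) mu s' <= 1 - alpha) ->
    `|fourier mu t| <= rho%:C].
Proof.
move=> al0 al1.
have [kap /andP[kap0 kap1] hkap] :
  exists2 k : R, 0 < k <= 1 & forall x : A, x != 0 -> k <= 1 - complex.Re (chr z x).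
  by apply: finite_pos_lower_bound => x /Re_chr_lt1; lra.
exists (1 - kap * alpha / 2); split; [nra|nra|].
move=> mu t mu0 mu1 t0 bal.
rewrite -ler_sqr ?nnegrE ?normr_ge0 ?ler0c //; last by nra.
have nsq : `|fourier mu t| ^+ 2 =
    \sum_s \sum_s' (mu s * mu s')%:C * chr z (t * s - t * s').
  rewrite sqr_normc /fourier (rmorph_sum (@conjc R)) mulr_suml; apply: eq_bigr => s _.
  rewrite mulr_sumr; apply: eq_bigr => s' _.
  rewrite (rmorphM (@conjc R)) /= oppr0 chr_conj chrD // rmorphM /= complexr0; ring.
have real : \sum_s \sum_s' (mu s * mu s')%:C * chr z (t * s - t * s') \is Num.real.
  by rewrite -nsq rpredX // normr_real.
rewrite nsq.
rewrite -(RRe_real real) -rmorphXn lecR.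
have -> : complex.Re (\sum_s \sum_s' (mu s * mu s')%:C * chr z (t * s - t * s')) =
  \sum_s \sum_s' (mu s * mu s') * complex.Re (chr z (t * s - t * s')).
  rewrite (raddf_sum (@complex.Re R : Rcomplex R -> R)); apply: eq_bigr => s _.
  rewrite (raddf_sum (@complex.Re R : Rcomplex R -> R)); apply: eq_bigr => s' _.
  by case: (chr _ _) => u v /=; rewrite mul0r subr0.
have step s : \sum_s' (mu s * mu s') * complex.Re (chr z (t * s - t * s')) <=
    mu s * (1 - kap * alpha).
  under eq_bigr do rewrite -mulrA; rewrite -mulr_sumr ler_wpM2l //.
  apply: (@le_trans _ _ (\sum_s' (mu s' * (1 - kap) + (if t * s' == t * s then mu s' * kap else 0)))).
    apply: ler_sum => s' _; case: eqP => [->|/eqP ne].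
      by rewrite subrr chr0 /=; lra.
    rewrite addr0 ler_wpM2l // -subr_ge0.
    have /hkap : t * s - t * s' != 0 by rewrite subr_eq0 eq_sym.
    lra.
  rewrite big_split /= -big_mkcond -!mulr_suml mu1.
  have := bal s; nra.
apply: le_trans (ler_sum _ (fun s _ => step s)) _.
by rewrite -mulr_suml mu1; have := mulr_gt0 kap0 al0; nra.
Qed.

End FourierBound.

(** * Sum over sequences for one form, then average over the forms *)

Section MainEstimate.
Local Open Scope complex_scope.
Variables (R : realType) (N r : nat) (a : 'I_r -> nat) (z : R[i]) (rho : R).
Hypotheses (N_gt1 : (1 < N)%N) (a_gt0 : forall i, (0 < a i)%N).
Hypothesis a2_dvd : forall i j, (a i * a j %| N)%N.
Hypothesis prim_z : N.-primitive_root z.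
Hypotheses (rho_ge0 : 0 <= rho) (rho_lt1 : rho < 1).

Notation A := 'Z_N.
Notation V := 'M['Z_N]_(2, r).
Notation D := (lag_card N a).

(** Coefficient of the independent entry [p] in the phase. Pairs below the diagonal get [0], so they
    contribute a factor [1]. *)
Definition theta n (d : 'M[A]_r) (y : {ffun 'I_n -> V}) (p : 'I_n * 'I_n) : A :=
  if (p.1 < p.2)%N then bf a d (y p.1) (y p.2)
  else if p.1 == p.2 then qf a d (y p.1) else 0.

Definition char_prod n (phi : 'I_n * 'I_n -> A -> R[i]) d (y : {ffun 'I_n -> V}) :=
  \prod_p phi p (theta d y p).

Definition damped n (phi : 'I_n * 'I_n -> A -> R[i]) :=
  (forall p, phi p 0 = 1) /\
  (forall (p : 'I_n * 'I_n) (t : A), (p.1 <= p.2)%N -> t != 0 -> `|phi p t| <= rho%:C).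

Definition spans n (y : {ffun 'I_n -> V}) (H : {set V}) :=
  (forall k, y k \in H) /\ (forall x, x \in H -> exists k, y k = x).

Lemma sum_theta_neq0 n d (y : {ffun 'I_n -> V}) :
  (\sum_p ((theta d y p != 0)%R : nat) = wt (bz a d) (qz a d) y)%N.
Proof.
rewrite /wt /wt_off /wt_diag pair_bigA /=.
have -> : (\sum_(k < n) (~~ qz a d (y k) : nat) =
    \sum_(p : 'I_n * 'I_n) ((p.1 == p.2) && ~~ qz a d (y p.1) : nat))%N.
  rewrite -(pair_bigA _ (fun k l => (k == l) && ~~ qz a d (y k) : nat)) /=.
  apply: eq_bigr => k _; rewrite (bigD1 k) //= eqxx big1 ?addn0 // => l.
  by rewrite eq_sym => /negPf ->.
rewrite -big_split /=; apply: eq_bigr => -[k l] _ /=; rewrite /theta /=.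
have [kl|kl] := ltnP k l; last by case: (k == l); rewrite //= eqxx.
have -> : (k == l) = false by rewrite -val_eqE /= ltn_eqF.
by rewrite addn0.
Qed.

Lemma norm_char_prod n phi d (y : {ffun 'I_n -> V}) : damped phi ->
  `|char_prod phi d y| <= (rho ^+ wt (bz a d) (qz a d) y)%:C.
Proof.
move=> [phi0 phir]; rewrite -sum_theta_neq0 expr_sum rmorph_prod normr_prod.
apply: ler_prod => p _; rewrite normr_ge0 /=.
have [->|t0] := eqVneq (theta d y p) 0; first by rewrite phi0 normr1 expr0.
rewrite expr1; apply: phir => //; move: t0; rewrite /theta.
case: ltngtP => // pp; rewrite (_ : (p.1 == p.2) = false) ?eqxx //.
by rewrite -val_eqE /= gtn_eqF.
Qed.

Lemma char_prod_lagrangian n phi d (y : {ffun 'I_n -> V}) H : damped phi ->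
  lagrangian (bz a d) (qz a d) D H -> (forall k, y k \in H) -> char_prod phi d y = 1.
Proof.
move=> [phi0 _] /and3P[/isotropicP iso _ /forall_inP hq] yH.
rewrite /char_prod big1 // => p _; rewrite (_ : theta d y p = 0) //.
rewrite /theta; case: ifP => _; first by apply/eqP; exact: iso.
by case: ifP => _ //; apply/eqP; exact: hq.
Qed.

Lemma spans_pop n L (y : {ffun 'I_n -> V}) : (0 < n)%N ->
  [forall k, y k \in pop L y] -> spans y (pop L y).
Proof.
move=> n0 /forallP yP; split=> // x; rewrite inE => xpop.
suff /existsP[k /eqP kx] : [exists k, y k == x] by exists k.
apply: contraLR xpop; rewrite negb_exists => /forallP h.
by rewrite /occ big1 ?muln0 -?ltnNge // => k _; rewrite (negPf (h k)).
Qed.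

(** Sequences that fill a Lagrangian popular set contribute [1] each, the others at most
    [rho ^+ wt]. Each Lagrangian [H] contains [D ^ n] sequences, all but an exponentially small
    share having [H] as popular set. *)
Lemma fixed_form_estimate (d : 'M[A]_r) : exists tau K : R,
  [/\ 0 < tau, tau < 1, 0 <= K & forall n phi (gen : pred {ffun 'I_n -> V}),
    damped phi ->
    (forall y H, lagrangian (bz a d) (qz a d) D H -> spans y H -> gen y = onto a H) ->
    `|\sum_(y | gen y) char_prod phi d y - #|lag_onto a d|%:R * D%:R ^+ n|
      <= (K * tau ^+ n * D%:R ^+ n)%:C].
Proof.
have D0 := lag_card_gt0 N_gt1 a_gt0 a2_dvd.
have V0 : (0 < #|{: V}|)%N by apply/card_gt0P; exists 0.
have symB : symmetric (bz a d) by move=> x y; rewrite /bz bfC.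
have rad := card_radical N_gt1 a2_dvd d.
have isoD P : isotropic (bz a d) P -> (#|P| <= D)%N.
  exact: (card_isotropic_le N_gt1 prim_z (bfC a d) (bfDl a d) rad).
have isoP P : isotropic (bz a d) P -> #|P| = D -> perp (bz a d) P \subset P.
  move=> iso PD; rewrite (_ : perp (bz a d) P = P) //.
  exact: (perp_lagrangian N_gt1 prim_z (bfC a d) (bfDl a d) rad D0).
have [L [tau [K [tau0 tau1 K0 hK]]]] :=
  @popular_sum_bound R V (bz a d) (qz a d) D rho symB D0 V0 rho_ge0 rho_lt1 isoD isoP.
pose m : R := #|{set V}|%:R.
have m0 : 0 <= m by rewrite ler0n.
have mlag : #|lag_onto a d|%:R <= m :> R by rewrite ler_nat max_card.
exists tau, ((1 + m) * (1 + K)); split=> //; first by rewrite mulr_ge0 //; lra.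
move=> n phi gen damp hgen.
have dn0 : 0 <= tau ^+ n * D%:R ^+ n by rewrite mulr_ge0 ?exprn_ge0 // ltW.
(* For [n = 0] all of [V] is popular although the empty sequence spans nothing; the trivial bound
   [1 + m] is used. *)
have [n0|n0] := posnP n.
  subst n; rewrite !expr0 !mulr1.
  apply: le_trans (ler_normB _ _) _.
  apply: (@le_trans _ _ (1 + m)%:C); last by rewrite lecR ler_peMr //; lra.
  rewrite [leRHS]rmorphD /= lerD //; last first.
    by rewrite normr_nat -[leLHS](rmorph_nat (real_complex R)) lecR.
  apply: le_trans (ler_norm_sum _ _ _) _.
  apply: (@le_trans _ _ (\sum_(y : {ffun 'I_0 -> V}) 1)).
    rewrite [leLHS]big_mkcond; apply: ler_sum => y _; case: ifP => _ //.
    by rewrite /char_prod big1 ?normr1 // => -[[]].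
  by rewrite sumr_const card_ffun card_ord expn0.
have [hbad hcount] := hK n.
pose good (y : {ffun 'I_n -> V}) :=
  lagrangian (bz a d) (qz a d) D (pop L y) && [forall k, y k \in pop L y].
rewrite (bigID good) /= addrAC.
apply: le_trans (ler_normD _ _) _.
have -> : ((1 + m) * (1 + K) * tau ^+ n * D%:R ^+ n)%:C =
  (m * (1 + K) * (tau ^+ n * D%:R ^+ n))%:C + ((1 + K) * (tau ^+ n * D%:R ^+ n))%:C.
  by rewrite -rmorphD; congr (_%:C); ring.
apply: lerD; last first.
  apply: le_trans (ler_norm_sum _ _ _) _.
  apply: (@le_trans _ _ (\sum_(y | ~~ good y) (rho ^+ wt (bz a d) (qz a d) y)%:C)).
    rewrite [leLHS]big_mkcond [leRHS]big_mkcond; apply: ler_sum => y _.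
    case: (gen y); case: (good y) => //=; first exact: norm_char_prod.
    by rewrite ler0c exprn_ge0.
  rewrite -rmorph_sum lecR; apply: le_trans hbad _; rewrite -mulrA ler_wpM2r //; lra.
have -> : \sum_(y | gen y && good y) char_prod phi d y =
    (\sum_(H in lag_onto a d) \sum_(y : {ffun 'I_n -> V} |
        [forall k, y k \in H] && (pop L y == H)) 1)%:C.
  rewrite (partition_big (pop L) [in lag_onto a d]) /=; last first.
    move=> y /andP[gy /andP[lag yP]]; rewrite inE lag /=.
    by rewrite -(hgen y) //; exact: spans_pop.
  rewrite rmorph_sum; apply: eq_bigr => H; rewrite inE => /andP[lagH ontoH].
  rewrite rmorph_sum; apply: eq_big => y; last first.
    by move=> /andP[/andP[_ /andP[lag /forallP yP]] _]; rewrite (char_prod_lagrangian damp lag).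
  apply/andP/andP => [[/andP[_ /andP[_ yP]] /eqP <-]//|[yP /eqP pE]]; split; last exact/eqP.
  rewrite /good pE lagH yP !andbT.
  by rewrite (hgen y H) // -pE; apply: spans_pop; rewrite // pE.
have -> : #|lag_onto a d|%:R * D%:R ^+ n =
    (\sum_(H in lag_onto a d) \sum_(y : {ffun 'I_n -> V} | [forall k, y k \in H]) (1 : R))%:C.
  rewrite -(rmorph_nat (real_complex R) #|_|) -(rmorph_nat (real_complex R) D).
  rewrite -rmorphXn -rmorphM; congr (_%:C).
  rewrite (eq_bigr (fun=> D%:R ^+ n)) => [|H].
    by rewrite sumr_const -[RHS]mulr_natl.
  rewrite inE => /andP[/and3P[_ /eqP HD _] _].
  have := sum_ffun_prod n (fun x => if x \in H then (1 : R) else 0).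
  rewrite sum_weight mulr0 addr0 HD => <-; rewrite big_mkcond /=; apply: eq_bigr => y _.
  case: ifP => [/forallP h|/negbT]; first by rewrite big1 // => k _; rewrite h.
  by rewrite negb_forall => /existsP[k /negPf kH]; rewrite (bigD1 k) //= kH mul0r.
rewrite -rmorphB -sumrB normc_def /= expr0n /= addr0 sqrtr_sqr lecR.
apply: le_trans (ler_norm_sum _ _ _) _.
apply: (@le_trans _ _ (\sum_(H in lag_onto a d) (1 + K) * (tau ^+ n * D%:R ^+ n))).
  apply: ler_sum => H; rewrite inE => /andP[/and3P[_ /eqP HD _] _].
  rewrite [X in _ - X](bigID (fun y => pop L y == H)) /= opprD addrA subrr sub0r normrN.
  rewrite ger0_norm; last by apply: sumr_ge0.
  by apply: le_trans (hcount H HD) _; rewrite -mulrA ler_wpM2r //; lra.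
rewrite sumr_const -[leLHS]mulr_natl -[leRHS]mulrA ler_wpM2r // mulr_ge0 //; lra.
Qed.

Lemma averaged_estimate : exists tau K : R,
  [/\ 0 < tau, tau < 1, 0 <= K & forall n phi (gen : pred {ffun 'I_n -> V})
      (Q : 'I_r -> 'I_r -> A),
    damped phi ->
    (forall d y H, lagrangian (bz a d) (qz a d) D H -> spans y H -> gen y = onto a H) ->
    (forall i j, nu N a i * Q i j = 0) -> (forall i j, nu N a j * Q i j = 0) ->
    `|(N ^ (r * r))%:R^-1 * D%:R ^- n *
       (\sum_(d : 'M[A]_r) chr z (- \sum_i \sum_j nu2 N a i j * d i j * Q i j) *
          \sum_(y | gen y) char_prod phi d y) - (\prod_i a i)%:R^-1|
      <= (K * tau ^+ n)%:C].
Proof.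
have /choice[f hf] : forall d : 'M[A]_r, exists f : R * R,
  [/\ 0 < f.1, f.1 < 1, 0 <= f.2 & forall n phi (gen : pred {ffun 'I_n -> V}),
    damped phi ->
    (forall y H, lagrangian (bz a d) (qz a d) D H -> spans y H -> gen y = onto a H) ->
    `|\sum_(y | gen y) char_prod phi d y - #|lag_onto a d|%:R * D%:R ^+ n|
      <= (f.2 * f.1 ^+ n * D%:R ^+ n)%:C].
  move=> d; have [tau [K h]] := fixed_form_estimate d.
  by exists (tau, K).
have [kap /andP[kap0 kap1] hkap] :
    exists2 k : R, 0 < k <= 1 & forall d, xpredT d -> k <= 1 - (f d).1.
  by apply: finite_pos_lower_bound => d _; have [] := hf d; lra.
(* [1 - kap] dominates the rates of all [d]; halving [kap] keeps [tau] positive. *)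
pose tau := 1 - kap / 2; pose K := \sum_d (f d).2.
have K0 : 0 <= K by apply: sumr_ge0 => d _; have [] := hf d.
have D0 : 0 < D%:R :> R by rewrite ltr0n lag_card_gt0.
exists tau, K; split=> //; rewrite ?/tau; [lra|lra|].
move=> n phi gen Q damp hgen Ql Qr; rewrite -/tau.
have main := sum_lag_onto N_gt1 a_gt0 a2_dvd prim_z Ql Qr.
pose chi (d : 'M[A]_r) := chr z (- \sum_i \sum_j nu2 N a i j * d i j * Q i j).
have NN0 : (N ^ (r * r))%:R != 0 :> R[i] by rewrite pnatr_eq0 -lt0n expn_gt0 ltnW.
have DC0 : D%:R != 0 :> R[i] by rewrite pnatr_eq0 -lt0n lag_card_gt0.
have aaE : (\prod_i a i)%:R^-1 = (N ^ (r * r))%:R^-1 * D%:R ^- n *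
    \sum_(d : 'M[A]_r) chi d * (#|lag_onto a d|%:R * D%:R ^+ n) :> R[i].
  rewrite [X in _ * X](_ : _ = (N ^ (r * r))%:R / (\prod_i a i)%:R * D%:R ^+ n); last first.
    by rewrite -main mulr_suml; apply: eq_bigr => d _; rewrite mulrA.
  by rewrite [_ / _ * D%:R ^+ n]mulrAC mulrA -invfM mulVf ?mul1r ?mulf_neq0 ?expf_neq0.
rewrite aaE -mulrBr -sumrB normrM normrM !normfV normrX !normr_nat.
have -> : (K * tau ^+ n)%:C = (N ^ (r * r))%:R^-1 * D%:R ^- n *
    \sum_(d : 'M[A]_r) (K * tau ^+ n * D%:R ^+ n)%:C.
  set c := (K * tau ^+ n).
  have -> : \sum_(d : 'M[A]_r) (c * D%:R ^+ n)%:C = (N ^ (r * r))%:R * (c%:C * D%:R ^+ n).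
    rewrite sumr_const card_mx card_ord Zp_cast // -[LHS]mulr_natl; congr (_ * _).
    by rewrite rmorphM rmorphXn rmorph_nat.
  rewrite [_ * (c%:C * _)]mulrCA mulrC -mulrA -invfM mulfV ?mulr1 //.
  by rewrite mulf_neq0 ?expf_neq0.
apply: ler_wpM2l; first by rewrite mulr_ge0 ?invr_ge0 ?exprn_ge0.
apply: le_trans (ler_norm_sum _ _ _) _; apply: ler_sum => d _.
rewrite -mulrBr normrM (norm_chr N_gt1 prim_z) mul1r.
have [t0 t1 Kd0 hd] := hf d.
apply: le_trans (hd n phi gen damp _) _; first by move=> y H; exact: hgen.
rewrite lecR; apply: ler_wpM2r; first by rewrite exprn_ge0 ?ltW.
apply: ler_pM; rewrite ?exprn_ge0 ?(ltW t0) //.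
  rewrite /K (bigD1 d) //= lerDl; apply: sumr_ge0 => d' _; by have [] := hf d'.
have ft : (f d).1 <= tau by have := hkap d isT; rewrite /tau; lra.
by rewrite lerXn2r ?nnegrE ?(ltW t0) ?(le_trans (ltW t0) ft).
Qed.

End MainEstimate.

(** * Expansion of the expected count in characters *)

Section Expansion.
Variables (R : realType) (N r : nat) (a : 'I_r -> nat) (z : R[i]).
Hypotheses (N_gt1 : (1 < N)%N) (prim_z : N.-primitive_root z).

Notation A := 'Z_N.
Notation V := 'M['Z_N]_(2, r).

Lemma mx_orthogonality m n (u : 'I_m -> 'I_n -> A) :
  \sum_(c : 'M[A]_(m, n)) chr z (\sum_i \sum_j c i j * u i j) =
  if [forall i, forall j, u i j == 0] then (N ^ (m * n))%:R else 0.
Proof.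
pose f (c : 'M[A]_(m, n)) := \sum_i \sum_j c i j * u i j.
have -> : \sum_(c : 'M[A]_(m, n)) chr z (\sum_i \sum_j c i j * u i j) =
    \sum_(c in finset.setT) chr z (f c) by apply: eq_bigl => c; rewrite inE.
rewrite chr_sum_subgroup ?inE //; last first.
- move=> c c' _ _; rewrite /f -big_split; apply: eq_bigr => i _.
  by rewrite -big_split; apply: eq_bigr => j _; rewrite mxE mulrDl.
- by move=> c c' _ _; rewrite inE.
rewrite cardsT card_mx card_ord.
rewrite [X in (if _ then (X ^ _)%:R else _) = _]Zp_cast //; congr (if _ then _ else _).
apply/forall_inP/forallP => [h i|h c _].
  apply/forallP => j; have := h (delta_mx i j) (finset.in_setT _).
  rewrite /f (bigD1 i) //= (bigD1 j) //= mxE !eqxx mul1r big1 ?addr0 => [|l /negPf lj].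
    rewrite big1 ?addr0 // => k /negPf ki; rewrite big1 // => l _.
    by rewrite mxE ki mul0r.
  by rewrite mxE lj andbF mul0r.
rewrite /f big1 // => i _; rewrite big1 // => j _.
by have /forallP/(_ j)/eqP -> := h i; rewrite mulr0.
Qed.

Variable n : nat.
Implicit Types (m : 'M[A]_n) (X c : 'M[A]_(n, r)) (Q : 'I_r -> 'I_r -> A).

(** Its vanishing says that the homomorphism lifted by [X] kills column [l], read in the [i]-th
    cyclic factor. *)
Definition col_cond m X (l : 'I_n) (i : 'I_r) : A := nu N a i * \sum_k X k i * m k l.
Definition pair_cond m X Q (i j : 'I_r) : A :=
  nu2 N a i j * (\sum_k \sum_l X k i * m k l * X l j - Q i j).
Definition cond m Q X :=
  [forall l, forall i, col_cond m X l i == 0] &&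
  [forall i, forall j, pair_cond m X Q i j == 0].

Definition join_mx X c : {ffun 'I_n -> V} := [ffun k => pairV (X k) (c k)].
Definition fst_mx (y : {ffun 'I_n -> V}) : 'M[A]_(n, r) := \matrix_(k, i) y k 0 i.
Definition snd_mx (y : {ffun 'I_n -> V}) : 'M[A]_(n, r) := \matrix_(k, i) y k 1 i.

Lemma join_mxK y : join_mx (fst_mx y) (snd_mx y) = y.
Proof.
by apply/ffunP => k; rewrite ffunE; apply: matrix2P => i; rewrite ?pairV0 ?pairV1 mxE.
Qed.

Lemma fst_mxK X c : fst_mx (join_mx X c) = X.
Proof. by apply/matrixP => k i; rewrite mxE ffunE pairV0. Qed.

Lemma snd_mxK X c : snd_mx (join_mx X c) = c.
Proof. by apply/matrixP => k i; rewrite mxE ffunE pairV1. Qed.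

Lemma sum_theta m d (y : {ffun 'I_n -> V}) : (forall k l, m k l = m l k) ->
  \sum_k \sum_l m k l * beta a d (y k) (y l) = \sum_p m p.1 p.2 * theta a d y p.
Proof.
move=> symm; pose w k l := m k l * beta a d (y k) (y l).
have := sum_quadratic_fold (fun=> 1) w.
rewrite -(pair_bigA _ (fun k l => m k l * theta a d y (k, l))) /=.
under eq_bigr do under eq_bigr do rewrite !mul1r.
move=> ->; apply: eq_bigr => k _; apply: eq_bigr => l _; rewrite !mul1r /theta /w /=.
case: ifP => _; first by rewrite (symm l k) -mulrDr.
by case: eqP => [<-|_]; rewrite ?mulr0.
Qed.

(** This identity dictates the shape of [beta]: the dual variables [c] and [d] of the conditions
    regroup, entry by entry of [m], into a form in [(X k, c k)] and [(X l, c l)]. *)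
Lemma sum_beta_split m Q d X c :
  \sum_k \sum_l m k l * beta a d (join_mx X c k) (join_mx X c l) -
  \sum_i \sum_j nu2 N a i j * d i j * Q i j =
  \sum_l \sum_i c l i * col_cond m X l i + \sum_i \sum_j d i j * pair_cond m X Q i j.
Proof.
have -> : \sum_i \sum_j d i j * pair_cond m X Q i j =
  \sum_i \sum_j d i j * nu2 N a i j * \sum_k \sum_l X k i * m k l * X l j -
  \sum_i \sum_j nu2 N a i j * d i j * Q i j.
  rewrite -sumrB; apply: eq_bigr => i _; rewrite -sumrB; apply: eq_bigr => j _.
  by rewrite /pair_cond; ring.
rewrite addrA; congr (_ - _).
have -> : \sum_k \sum_l m k l * beta a d (join_mx X c k) (join_mx X c l) =
  \sum_k \sum_l m k l * \sum_i nu N a i * X k i * c l i +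
  \sum_k \sum_l m k l * \sum_i \sum_j nu2 N a i j * d i j * X k i * X l j.
  rewrite -big_split /=; apply: eq_bigr => k _; rewrite -big_split /=; apply: eq_bigr => l _.
  rewrite -mulrDr /beta !ffunE; congr (_ * (_ + _)); apply: eq_bigr => i _.
    by rewrite pairV0 pairV1.
  by apply: eq_bigr => j _; rewrite !pairV0.
congr (_ + _).
  rewrite exchange_big /=; apply: eq_bigr => l _.
  under eq_bigr do rewrite mulr_sumr.
  rewrite exchange_big /=; apply: eq_bigr => i _.
  by rewrite /col_cond !mulr_sumr; apply: eq_bigr => k _; ring.
transitivity (\sum_k \sum_l \sum_i \sum_j d i j * nu2 N a i j * (X k i * m k l * X l j)).
  apply: eq_bigr => k _; apply: eq_bigr => l _; rewrite mulr_sumr.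
  by apply: eq_bigr => i _; rewrite mulr_sumr; apply: eq_bigr => j _; ring.
rewrite pair_bigA /= exchange_big /=; under [LHS]eq_bigr do rewrite exchange_big /=.
apply: eq_bigr => i _; apply: eq_bigr => j _; rewrite mulr_sumr.
by under [RHS]eq_bigr do rewrite mulr_sumr; rewrite pair_bigA.
Qed.

(** Orthogonality in [c] and in [d] detects [cond]; the pair [(X, c)] is then read as one sequence
    in [V]. *)
Lemma count_expansion m Q (gen : pred {ffun 'I_n -> V}) (genX : pred 'M[A]_(n, r)) :
  (forall k l, m k l = m l k) -> (forall y, gen y = genX (fst_mx y)) ->
  (N ^ (n * r))%:R * (N ^ (r * r))%:R *
    #|[set X : 'M[A]_(n, r) | genX X && cond m Q X]%SET|%:R =
  \sum_(d : 'M[A]_r) chr z (- \sum_i \sum_j nu2 N a i j * d i j * Q i j) *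
    \sum_(y | gen y) chr z (\sum_p m p.1 p.2 * theta a d y p) :> R[i].
Proof.
move=> symm genE.
transitivity (\sum_(d : 'M[A]_r) \sum_(X | genX X) \sum_(c : 'M[A]_(n, r))
   chr z (\sum_l \sum_i c l i * col_cond m X l i) *
   chr z (\sum_i \sum_j d i j * pair_cond m X Q i j)).
  rewrite exchange_big /=.
  rewrite -sum1_card natr_sum mulr_sumr.
  rewrite [LHS](eq_bigl (fun X => genX X && cond m Q X)) => [|X]; last by rewrite inE.
  rewrite big_mkcondr /=; apply: eq_bigr => X _.
  rewrite (eq_bigr _ (fun d _ => esym (mulr_suml _ _ _ _))) -mulr_sumr.
  rewrite !mx_orthogonality mulr1 /cond.
  case: [forall l, forall i, col_cond m X l i == 0]; rewrite /= ?mul0r //.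
  by case: ifP => _; rewrite ?mulr0.
apply: eq_bigr => d _; rewrite mulr_sumr.
rewrite (reindex (fun Xc : 'M[A]_(n, r) * 'M[A]_(n, r) => join_mx Xc.1 Xc.2)) /=; last first.
  exists (fun y => (fst_mx y, snd_mx y)) => [[X c]|y] _ /=; last exact: join_mxK.
  by rewrite fst_mxK snd_mxK.
rewrite (eq_bigl (fun Xc => genX Xc.1)); last by move=> Xc; rewrite genE fst_mxK.
rewrite pair_big_dep /=; apply: eq_big => [[X c]|[X c] _] /=; first by rewrite andbT.
by rewrite -!chrD // -sum_beta_split sum_theta // addrC.
Qed.

Definition sym_mx (S : {ffun 'I_n * 'I_n -> A}) : 'M[A]_n :=
  \matrix_(k, l) if (k <= l)%N then S (k, l) else S (l, k).

Lemma sym_mxC S k l : sym_mx S k l = sym_mx S l k.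
Proof. by rewrite !mxE; case: ltngtP => // /val_inj ->. Qed.

Local Open Scope complex_scope.

(** The weights form a product, so summing the character over [S] gives a product of Fourier
    coefficients. Entries of [S] below the diagonal do not enter [sym_mx], in accordance with
    [theta] being [0] there. *)
Lemma expected_count (mu : 'I_n * 'I_n -> A -> R) Q
    (gen : pred {ffun 'I_n -> V}) (genX : pred 'M[A]_(n, r)) :
  (forall y, gen y = genX (fst_mx y)) ->
  (N ^ (n * r))%:R * (N ^ (r * r))%:R *
    (\sum_(S : {ffun 'I_n * 'I_n -> A}) (\prod_p mu p (S p)) *
      #|[set X : 'M[A]_(n, r) | genX X && cond (sym_mx S) Q X]%SET|%:R)%:C =
  \sum_(d : 'M[A]_r) chr z (- \sum_i \sum_j nu2 N a i j * d i j * Q i j) *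
    \sum_(y | gen y) char_prod a (fun p => fourier z (mu p)) d y.
Proof.
move=> genE; rewrite rmorph_sum mulr_sumr.
transitivity (\sum_(S : {ffun 'I_n * 'I_n -> A}) (\prod_p mu p (S p))%:C * \sum_(d : 'M[A]_r)
    chr z (- \sum_i \sum_j nu2 N a i j * d i j * Q i j) *
    \sum_(y | gen y) chr z (\sum_p sym_mx S p.1 p.2 * theta a d y p)).
  apply: eq_bigr => S _; rewrite -(count_expansion Q (sym_mxC S) genE).
  by rewrite rmorphM rmorph_nat mulrCA.
under eq_bigr do rewrite mulr_sumr.
rewrite exchange_big /=; apply: eq_bigr => d _.
under eq_bigr do rewrite mulrCA mulr_sumr.
rewrite -mulr_sumr; congr (_ * _); rewrite exchange_big /=; apply: eq_bigr => y _.
rewrite /char_prod /fourier (bigA_distr_bigA (fun p s => (mu p s)%:C * chr z (theta a d y p * s))).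
apply: eq_bigr => S _; rewrite big_split /= rmorph_prod; congr (_ * _).
rewrite chr_sum //; apply: eq_bigr => -[k l] _ /=; congr (chr z _).
rewrite mulrC /theta mxE /=; case: ltngtP => // kl.
by rewrite (_ : (k == l) = false) ?mul0r // -val_eqE /= gtn_eqF.
Qed.

End Expansion.

(** * Bases of a finite abelian group *)

Section Basis.
Variable G : finZmodType.

Definition is_basis r (g : 'I_r -> G) (a : 'I_r -> nat) :=
  [/\ forall i, (0 < a i)%N, (\prod_i a i = #|G|)%N,
      forall x, exists c : 'I_r -> nat, x = \sum_i g i *+ c i &
      forall c : 'I_r -> int,
        \sum_i g i *~ c i = 0 <-> forall i, ((a i)%:Z %| c i)%Z].

(** The reduced coefficient vectors form a set of [#|G|] elements mapping onto [G], hence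
    injectively, so every relation reduces to [0]. Entries live in ['I_(#|G|.+1)], one type for all
    the ranges [a i], so that [card_mx_box] applies. *)
Lemma spanning_family_basis r (g : 'I_r -> G) (a : 'I_r -> nat) :
  (forall i, 0 < a i)%N -> (\prod_i a i = #|G|)%N -> (forall i, g i *+ a i = 0) ->
  (forall x, exists c : 'I_r -> nat, x = \sum_i g i *+ c i) -> is_basis g a.
Proof.
move=> a0 acard ga span; split=> // c.
have aG i : (a i <= #|G|)%N.
  by rewrite -acard (bigD1 i) //= leq_pmulr // prodn_gt0.
pose f (x : 'rV['I_(#|G|.+1)]_r) := \sum_i g i *+ x 0 i.
pose S := [set x : 'rV['I_(#|G|.+1)]_r | [forall k, forall i,
  x k i \in [set t : 'I_(#|G|.+1) | t < a i]]]%N%SET.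
have gmod i (t : int) : g i *~ t = g i *+ `|(t %% (a i)%:Z)%Z|%N.
  rewrite {1}(divz_eq t (a i)%:Z) mulrzDr mulrC mulrzA -pmulrn ga mul0rz add0r.
  rewrite pmulrn gez0_abs // modz_ge0 //.
  by have := a0 i; lia.
have redlt i (t : int) : (`|(t %% (a i)%:Z)%Z|%N < a i)%N.
  have := ltz_pmod t (_ : 0 < (a i)%:Z); have := modz_ge0 t (_ : (a i)%:Z != 0).
  by have := a0 i; lia.
pose red (t : 'I_r -> int) : 'rV['I_(#|G|.+1)]_r := \row_i inord `|(t i %% (a i)%:Z)%Z|%N.
have redE t i : red t 0 i = `|(t i %% (a i)%:Z)%Z|%N :> nat.
  by rewrite mxE inordK // ltnS (leq_trans (ltnW (redlt i _))).
have redS t : red t \in S.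
  rewrite inE; apply/forallP => k; apply/forallP => i; rewrite inE (ord1 k) redE.
  exact: redlt.
have fred t : f (red t) = \sum_i g i *~ t i.
  by apply: eq_bigr => i _; rewrite redE gmod.
have injf : {in S &, injective f}.
  apply/imset_injP; rewrite (_ : f @: S = finset.setT); last first.
    apply/setP => x; rewrite inE; apply/imsetP; have [t xt] := span x.
    exists (red (fun i => (t i)%:Z)); rewrite ?redS // fred xt.
    by apply: eq_bigr => i _; rewrite pmulrn.
  rewrite cardsT /S card_mx_box big_ord1; apply/eqP; rewrite -[LHS]acard.
  apply: eq_bigr => i _.
  rewrite -[LHS]card_ord -[LHS]cardsT.
  rewrite -(card_imset _ (_ : injective (fun k : 'I_(a i) => widen_ord (leqW (aG i)) k))).
    apply: eq_card => t; rewrite inE; apply/imsetP/idP => [[k _ ->]|ta] /=; first exact: ltn_ord.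
    by exists (Ordinal ta) => //; exact/val_inj.
  by move=> k l /(congr1 val) /= kl; exact/val_inj.
split=> [c0 i|h]; last first.
  by rewrite big1 // => i _; rewrite gmod (dvdz_mod0P (h i)).
have /injf : f (red c) = f (red (fun=> 0)) by rewrite !fred c0 big1 // => j _; rewrite mulr0z.
move=> /(_ (redS _) (redS _)) /(congr1 (fun x : 'rV['I_(#|G|.+1)]_r => x 0 i : nat)).
by rewrite !redE mod0z /= => /eqP; rewrite absz_eq0 => /eqP/dvdz_mod0P.
Qed.

Lemma exists_basis : exists r (g : 'I_r -> G) (a : 'I_r -> nat), is_basis g a.
Proof.
have [b defG _] := abelian_structure (FinRing.zmod_abelian [set: G]%G).
exists (size b), (fun i => b`_i), (fun i => #[b`_i]%g).
apply: spanning_family_basis => [i||i|x].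
- exact: order_gt0.
- rewrite -cardsT -(bigdprod_card defG) (big_nth 0) big_mkord.
  by apply: eq_bigr => i _; rewrite orderE.
- by rewrite -FinRing.zmodXgE expg_order.
have : x \in (\prod_(y <- b) <[y]>)%g by rewrite (bigdprodW defG) inE.
rewrite (big_nth 0) big_mkord => /prodsgP[c cP ->].
have /fin_all_exists[t ct] : forall i : 'I_(size b), exists t, c i = b`_i *+ t.
  by move=> i; have /cycleP[t ->] := cP i isT; exists t; rewrite FinRing.zmodXgE.
by exists t; apply: eq_bigr => i _; rewrite ct.
Qed.

End Basis.

Section ZpInt.
Variable N : nat.
Hypothesis N_gt1 : (1 < N)%N.

Lemma Zp_intr_eq0 (t : int) : ((t%:~R : 'Z_N) == 0) = (N%:Z %| t)%Z.
Proof.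
by case: t => k; rewrite ?NegzE ?mulrNz ?oppr_eq0 -?pmulrn Zp_natr_eq0 ?dvdzN.
Qed.

Lemma Zp_quot_mul_intr_eq0 m (t : int) : (m %| N)%N ->
  (((N %/ m)%:R * t%:~R : 'Z_N) == 0) = (m%:Z %| t)%Z.
Proof.
move=> mN; rewrite (_ : _ * _ = ((N %/ m)%:Z * t)%:~R); last by rewrite intrM.
rewrite Zp_intr_eq0 !dvdzE abszM /=.
have N0 : (0 < N)%N by exact: ltnW.
have -> : (N %| N %/ m * `|t|)%N = (N %/ m * m %| N %/ m * `|t|)%N by rewrite divnK.
rewrite dvdn_pmul2l // divn_gt0; last exact: dvdn_gt0 mN.
exact: dvdn_leq.
Qed.

End ZpInt.

Lemma additive_exists (U W : zmodType) (f : U -> W) : zmod_morphism f ->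
  exists F : {additive U -> W}, F =1 f.
Proof.
move=> fB; pose mF := GRing.isZmodMorphism.Build U W f fB.
by pose F : {additive U -> W} := HB.pack f mF; exists F.
Qed.

Lemma rat_div_int (m : nat) (t : int) : (0 < m)%N ->
  (t%:~R / m%:R \is a @Num.int rat) <-> (m%:Z %| t)%Z.
Proof.
move=> m0; have mq : m%:R != 0 :> rat by rewrite pnatr_eq0 -lt0n.
split=> [/intrP[q e]|/dvdzP[q ->]].
  apply/dvdzP; exists q; apply: (@intr_inj rat).
  by rewrite intrM -e divfK.
by rewrite intrM mulfK // intr_int.
Qed.

(** * Pairings, homomorphisms from the cokernel, and the dual basis *)

Section PairingZero.
Variables (G : finZmodType) (pG : sym_pairing G).

Lemma pairing0l (v : dual G) : pG (\0 : dual G) v = 0.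
Proof.
apply: (addrI (pG (\0 : dual G) v)); rewrite -pairingDl addr0; congr (pG _ _).
by apply: additive_ext => x /=; rewrite addr0.
Qed.

Lemma pairing_mull (u v w : dual G) m : (forall x, w x = u x *+ m) ->
  pG w v = pG u v *+ m.
Proof.
elim: m w => [|m IH] w wE.
  rewrite mulr0n -(pairing0l v); congr (pG _ _); apply: additive_ext => x.
  by rewrite wE mulr0n.
have [w' w'E] : exists w' : dual G, w' =1 fun x => u x *+ m.
  by apply: additive_exists => x y; rewrite raddfB mulrnBl.
rewrite mulrS -(IH w' w'E) -pairingDl; congr (pG _ _).
by apply: additive_ext => x /=; rewrite wE mulrS w'E.
Qed.

End PairingZero.

Section CokPairing.
Variables (n : nat) (M : 'M[int]_n).
Hypothesis symM : M^T = M.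
Implicit Types x y : dual (cok M).

Lemma cok_pairingDl x x' y :
  cok_pairing (x \+ x') y = cok_pairing x y + cok_pairing x' y.
Proof.
have lx := some_liftP x; have lx' := some_liftP x'; have ly := some_liftP y.
have lD : is_lift (x \+ x') (some_lift x + some_lift x').
  by move=> v /=; rewrite lx lx' -raddfD; congr toQmodZ; rewrite mulmxDl [RHS]mxE.
rewrite (cok_pairingE symM lD ly) (cok_pairingE symM lx ly) (cok_pairingE symM lx' ly).
by rewrite -raddfD; congr toQmodZ; rewrite !mulmxDl [LHS]mxE.
Qed.

Lemma cok_pairingC x y : cok_pairing x y = cok_pairing y x.
Proof.
have lx := some_liftP x; have ly := some_liftP y.
rewrite (cok_pairingE symM lx ly) (cok_pairingE symM ly lx); congr toQmodZ.
set Z := _ *m _; have -> : Z 0 0 = Z^T 0 0 by rewrite [RHS]mxE.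
by rewrite /Z !trmx_mul trmxK map_trmx symM mulmxA.
Qed.

Lemma cok_pairing0l y : cok_pairing (\0 : dual (cok M)) y = 0.
Proof.
have l0 : is_lift (\0 : dual (cok M)) 0 by move=> v /=; rewrite mul0mx mxE raddf0.
by rewrite (cok_pairingE symM l0 (some_liftP y)) !mul0mx mxE raddf0.
Qed.

Variable G : finZmodType.

Lemma hom_tocok (F : {additive cok M -> G}) v :
  F (tocok M v) = \sum_k F (tocok M (delta_mx k 0)) *~ v k 0.
Proof.
rewrite {1}[v]matrix_sum_delta; under eq_bigr do rewrite big_ord1.
rewrite !raddf_sum; apply: eq_bigr => i _.
by rewrite -{1}[v i 0]intz scaler_int !raddfMz.
Qed.

Lemma hom_tocok_exists (f : 'I_n -> G) :
  (forall l, \sum_k f k *~ M k l = 0) ->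
  exists F : {additive cok M -> G}, forall v, F (tocok M v) = \sum_k f k *~ v k 0.
Proof.
move=> f0; pose h (v : 'cV[int]_n) := \sum_k f k *~ v k 0.
have hB u v : h (u - v) = h u - h v.
  by rewrite -sumrB; apply: eq_bigr => k _; rewrite !mxE mulrzBr.
have hM w : h (M *m w) = 0.
  transitivity (\sum_k \sum_l f k *~ M k l *~ w l 0).
    by apply: eq_bigr => k _; rewrite mxE mulrz_sumr; apply: eq_bigr => l _; rewrite mulrzA.
  by rewrite exchange_big big1 //= => l _; rewrite -mulrz_suml f0 mul0rz.
have hE u v : tocok M u = tocok M v -> h u = h v.
  by move=> /tocok_eq[w e]; apply/eqP; rewrite -subr_eq0 -hB e hM.
have repP (x : cok M) : exists v, tocok M v = x by exact: tocok_surj.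
have /choice[s sP] := repP.
have [F FE] : exists F : {additive cok M -> G}, F =1 h \o s.
  apply: additive_exists => x y /=; rewrite -hB; apply: hE.
  by rewrite raddfB /= !sP.
by exists F => v; rewrite FE /=; apply: hE; rewrite sP.
Qed.

Lemma num_Surstar_card (pG : sym_pairing G) : num_Surstar M pG =
  #|[set f : {ffun 'I_n -> G} | `[< exists2 F : {additive cok M -> G},
      Surstar pG F & forall k, F (tocok M (delta_mx k 0)) = f k >]]%SET|.
Proof.
pose ev (F : {classic {additive cok M -> G}}) : {ffun 'I_n -> G} :=
  [ffun i => (F : {additive cok M -> G}) (tocok M (delta_mx i 0))].
have inj_ev : injective ev.
  move=> F1 F2 /ffunP e; apply/additive_ext => x.
  have [v <-] := tocok_surj x; rewrite !hom_tocok; apply: eq_bigr => i _.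
  by have := e i; rewrite !ffunE => ->.
rewrite /num_Surstar; set S := fset_set _.
have -> : (#|` S| = size (map ev S))%N by rewrite size_map.
have /card_uniqP <- : uniq (map ev S) by rewrite map_inj_uniq // fset_uniq.
apply: eq_card => f; rewrite inE; apply/mapP/asboolP => [[F FS ->]|[F SF FE]].
  exists F => [|k]; last by rewrite ffunE.
  by move: FS; rewrite in_fset_set ?inE //; exact: Surstar_finite.
exists F; last by apply/ffunP => k; rewrite ffunE FE.
by rewrite in_fset_set ?inE //; exact: Surstar_finite.
Qed.

End CokPairing.

Section DualBasis.
Variables (G : finZmodType) (r : nat) (g : 'I_r -> G) (a : 'I_r -> nat).
Hypothesis bas : is_basis g a.

(** Coordinates are determined modulo [a i], so the coordinate divided by [a i] is determined modulo
    [1]. *)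
Lemma dual_basis_exists : exists eps : 'I_r -> dual G,
  forall i (c : 'I_r -> int),
    eps i (\sum_j g j *~ c j) = toQmodZ ((c i)%:~R / (a i)%:R).
Proof.
have [a0 _ span rel] := bas.
have /choice[co coP] := span.
have key x (c : 'I_r -> int) i : x = \sum_j g j *~ c j ->
    toQmodZ ((co x i)%:R / (a i)%:R) = toQmodZ ((c i)%:~R / (a i)%:R).
  move=> xE; apply/toQmodZ_eq.
  have /rel/(_ i) : \sum_j g j *~ ((co x j)%:Z - c j) = 0.
    transitivity (\sum_j g j *+ co x j - \sum_j g j *~ c j).
      by rewrite -sumrB; apply: eq_bigr => j _; rewrite mulrzBr pmulrn.
    by rewrite -xE -coP subrr.
  by move/(rat_div_int _ (a0 i)); rewrite intrB mulrBl.
suff /choice[eps epsP] : forall i, exists e : dual G,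
    e =1 fun x => toQmodZ ((co x i)%:R / (a i)%:R).
  by exists eps => i c; rewrite epsP; exact: key.
move=> i; apply: additive_exists => x y.
rewrite (key _ (fun j => (co x j)%:Z - (co y j)%:Z)); last first.
  transitivity (\sum_j g j *+ co x j - \sum_j g j *+ co y j); first by rewrite -!coP.
  by rewrite -sumrB; apply: eq_bigr => j _; rewrite mulrzBr !pmulrn.
by rewrite -raddfB /= intrB mulrBl.
Qed.

Variable eps : 'I_r -> dual G.
Hypothesis epsP : forall i (c : 'I_r -> int),
  eps i (\sum_j g j *~ c j) = toQmodZ ((c i)%:~R / (a i)%:R).

(** Every [u] is the sum of [t i] copies of [eps i], where [u (g i)] is [t i / a i] modulo [1]. *)
Lemma dual_basis_ind (P : dual G -> Prop) : P (\0 : dual G) ->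
  (forall u v, P u -> P v -> P (u \+ v)) -> (forall i, P (eps i)) -> forall u, P u.
Proof.
have [a0 _ span rel] := bas.
move=> P0 PD Pe u.
have ga i : g i *+ a i = 0.
  have /rel : forall k, ((a k)%:Z %| (if k == i then (a i)%:Z else 0))%Z.
    by move=> k; case: eqP => [->|_]; rewrite ?dvdzz ?dvdz0.
  rewrite (bigD1 i) //= eqxx big1 ?addr0 ?pmulrn // => k /negPf ->.
  exact: mulr0z.
have tP i : exists t : nat, u (g i) = toQmodZ (t%:R / (a i)%:R).
  have aq : (a i)%:R != 0 :> rat by rewrite pnatr_eq0 -lt0n.
  pose q := ofQmodZ (u (g i)).
  have /intrP[b bE] : q * (a i)%:R \is a Num.int.
    rewrite -[q * _]subr0; apply/toQmodZ_eq.
    by rewrite mulr_natr raddfMn /= ofQmodZK -raddfMn ga !raddf0.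
  exists `|(b %% (a i)%:Z)%Z|%N; rewrite -[LHS]ofQmodZK; apply/toQmodZ_eq.
  have bm : (`|(b %% (a i)%:Z)%Z|%N)%:R = (b %% (a i)%:Z)%Z%:~R :> rat.
    by rewrite pmulrn gez0_abs // modz_ge0 //; have := a0 i; lia.
  have -> : ofQmodZ (u (g i)) = b%:~R / (a i)%:R by rewrite -bE mulfK.
  rewrite bm -mulrBl -intrB; apply/rat_div_int => //.
  by rewrite {1}(divz_eq b (a i)%:Z) addrK dvdz_mull.
have /choice[t {}tP] := tP.
have Pm i m : exists2 w : dual G, (forall x, w x = eps i x *+ m) & P w.
  elim: m => [|m [w wE Pw]]; first by exists (\0 : dual G) => // x; rewrite mulr0n.
  by exists (eps i \+ w : dual G) => [x|]; [rewrite /= wE mulrS|exact: PD].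
have Ps (s : seq 'I_r) : exists2 w : dual G,
    (forall x, w x = \sum_(i <- s) eps i x *+ t i) & P w.
  elim: s => [|i s [w wE Pw]].
    by exists (\0 : dual G) => // x; rewrite big_nil.
  have [w' w'E Pw'] := Pm i (t i).
  by exists (w' \+ w : dual G) => [x|]; [rewrite /= big_cons w'E wE|exact: PD].
have [w wE Pw] := Ps (index_enum 'I_r).
rewrite (_ : u = w) //; apply: additive_ext => x; rewrite wE.
have [c xE] := span x.
have xE' : x = \sum_j g j *~ (c j)%:Z by rewrite xE; apply: eq_bigr => j _; rewrite pmulrn.
rewrite {1}xE raddf_sum; apply: eq_bigr => i _.
rewrite raddfMn /= tP xE' epsP -!raddfMn /=; congr toQmodZ.
by rewrite -pmulrn -[LHS]mulr_natr -[RHS]mulr_natr; ring.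
Qed.

Variable pG : sym_pairing G.

(** [a i] kills [eps i] and [a j] kills [eps j], so a representative [p] of the pairing has
    [p * a i] and [p * a j] integral, and [Q i j = p * a i * a j] is a multiple of both. These
    divisibilities are the hypotheses on [Q] in [sum_lag_onto]. *)
Lemma pairing_int_exists : exists Q : 'I_r -> 'I_r -> int, forall i j,
  [/\ pG (eps i) (eps j) = toQmodZ ((Q i j)%:~R / (a i * a j)%:R),
      ((a i)%:Z %| Q i j)%Z & ((a j)%:Z %| Q i j)%Z].
Proof.
have [a0 _ span rel] := bas.
suff h i : forall j, exists q : int,
    [/\ pG (eps i) (eps j) = toQmodZ (q%:~R / (a i * a j)%:R),
      ((a i)%:Z %| q)%Z & ((a j)%:Z %| q)%Z].
  by exists (fun i => projT1 (choice (h i))) => i j; exact: (projT2 (choice (h i)) j).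
move=> j.
have aeps k x : eps k x *+ a k = 0.
  have [c ->] := span x; have := epsP k (fun l => (c l)%:Z).
  rewrite (eq_bigr (fun l => g l *+ c l)) => [->|l _]; last by rewrite pmulrn.
  rewrite -raddfMn -(raddf0 toQmodZ); apply/toQmodZ_eq; rewrite subr0.
  by rewrite -[X in X \is a _]mulr_natr divfK ?intr_int // pnatr_eq0 -lt0n.
have pa k v : pG (eps k) v *+ a k = 0.
  by rewrite -(@pairing_mull G pG (eps k) v (\0 : dual G)) ?pairing0l.
have aq k : (a k)%:R != 0 :> rat by rewrite pnatr_eq0 -lt0n.
pose p := ofQmodZ (pG (eps i) (eps j)).
have /intrP[b bE] : p * (a i)%:R \is a Num.int.
  rewrite -[p * _]subr0; apply/toQmodZ_eq.
  by rewrite mulr_natr raddfMn /= ofQmodZK pa raddf0.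
have /intrP[b' b'E] : p * (a j)%:R \is a Num.int.
  rewrite -[p * _]subr0; apply/toQmodZ_eq.
  by rewrite mulr_natr raddfMn /= ofQmodZK pairingC pa raddf0.
exists (b * (a j)%:Z); split.
- rewrite -[LHS]ofQmodZK -/p; congr toQmodZ.
  by rewrite intrM -bE natrM -pmulrn; field; rewrite !aq.
- suff -> : b * (a j)%:Z = b' * (a i)%:Z by rewrite dvdz_mull.
  by apply: (@intr_inj rat); rewrite !intrM -bE -b'E -!pmulrn; ring.
by rewrite dvdz_mull.
Qed.

Variables (n : nat) (M : 'M[int]_n).
Hypothesis symM : M^T = M.

Lemma pairing_on_basis (F : {additive cok M -> G}) :
  (forall u v : dual G, cok_pairing (u \o F) (v \o F) = pG u v) <->
  (forall i j : 'I_r, (i <= j)%N ->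
    cok_pairing (eps i \o F) (eps j \o F) = pG (eps i) (eps j)).
Proof.
split=> [h i j _|h]; first exact: h.
have h' i j : cok_pairing (eps i \o F) (eps j \o F) = pG (eps i) (eps j).
  have [ij|/ltnW ij] := leqP i j; first exact: h.
  by rewrite (cok_pairingC symM) pairingC; exact: h.
have l0 v : cok_pairing ((\0 : dual G) \o F) (v : dual (cok M)) = 0.
  by rewrite -(cok_pairing0l symM v).
have lD (u u' : dual G) v : cok_pairing ((u \+ u' : dual G) \o F) (v : dual (cok M)) =
    cok_pairing (u \o F) v + cok_pairing (u' \o F) v.
  by rewrite -(cok_pairingDl symM); congr (cok_pairing _ _); apply: additive_ext.
move=> u v; move: u.
apply: dual_basis_ind => [|u u' hu hu'|i]; first by rewrite l0 pairing0l.
  by rewrite lD pairingDl hu hu'.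
rewrite (cok_pairingC symM) pairingC; move: v.
apply: dual_basis_ind => [|u u' hu hu'|j]; first by rewrite l0 pairing0l.
  by rewrite lD pairingDl hu hu'.
exact: h'.
Qed.

Lemma cok_pairing_eps (F : {additive cok M -> G}) (X : 'I_n -> 'I_r -> int) i j :
  (forall k, F (tocok M (delta_mx k 0)) = \sum_i g i *~ X k i) ->
  cok_pairing (eps i \o F) (eps j \o F) =
  toQmodZ ((\sum_k \sum_l X k i * M k l * X l j)%:~R / (a i * a j)%:R).
Proof.
move=> FE.
have lift i' : is_lift (eps i' \o F : dual (cok M)) (\row_k ((X k i')%:~R / (a i')%:R)).
  move=> v /=; rewrite hom_tocok raddf_sum mxE raddf_sum; apply: eq_bigr => k _.
  by rewrite raddfMz /= FE epsP -raddfMz /= !mxE mulrzr.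
rewrite (cok_pairingE symM (lift i) (lift j)); congr toQmodZ.
rewrite exchange_big mxE rmorph_sum mulr_suml /=; apply: eq_bigr => l _.
rewrite !mxE rmorph_sum !mulr_suml; apply: eq_bigr => k _; rewrite !mxE !rmorphM /= ?natrM.
by rewrite invfM; ring.
Qed.

End DualBasis.

(** * Lifting homomorphisms to matrices over [Z/N] *)

Section Model.
Variables (G : finZmodType) (r : nat) (g : 'I_r -> G) (a : 'I_r -> nat).
Hypotheses (bas : is_basis g a) (G_gt1 : (1 < #|G|)%N).

Local Notation N := (#|G| ^ 2)%N.
Local Notation A := 'Z_(#|G| ^ 2).
Local Notation V := 'M['Z_(#|G| ^ 2)]_(2, r).

Lemma sqr_card_gt1 : (1 < N)%N.
Proof. by rewrite -(exp1n 2) ltn_sqr. Qed.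

Lemma basis_a_gt0 i : (0 < a i)%N. Proof. by have [] := bas. Qed.

Lemma basis_a2_dvd i j : (a i * a j %| N)%N.
Proof.
have [_ aG _ _] := bas.
have h k : (a k %| #|G|)%N by rewrite -aG (bigD1 k) //= dvdn_mulr.
by rewrite expnS expn1 dvdn_mul.
Qed.

Let N_gt1 := sqr_card_gt1.

Lemma nu_intr_eq0 i (t : int) : (nu N a i * t%:~R == 0) = ((a i)%:Z %| t)%Z.
Proof. exact: (Zp_quot_mul_intr_eq0 N_gt1 _ (a_dvd basis_a2_dvd i)). Qed.

Lemma Zp_intrE (x : A) : ((x : nat)%:Z)%:~R = x.
Proof. by rewrite -pmulrn natr_Zp. Qed.

(** The projection [(Z/N)^r -> G]; using natural representatives is harmless because [a i] divides
    [N]. *)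
Definition piG (X : 'I_r -> A) : G := \sum_i g i *~ (X i : nat)%:Z.

Lemma piG_eq X (c : 'I_r -> int) :
  piG X = \sum_i g i *~ c i <-> forall i, nu N a i * (X i - (c i)%:~R) = 0.
Proof.
have [_ _ _ rel] := bas.
transitivity (\sum_i g i *~ ((X i : nat)%:Z - c i) = 0).
  have -> : \sum_i g i *~ ((X i : nat)%:Z - c i) = piG X - \sum_i g i *~ c i.
    by rewrite -sumrB; apply: eq_bigr => i _; rewrite mulrzBr.
  by split=> [->|/eqP]; rewrite ?subrr // subr_eq0 => /eqP.
rewrite rel; split=> h i; have := h i.
  by rewrite -nu_intr_eq0 intrB Zp_intrE => /eqP.
by rewrite -nu_intr_eq0 intrB Zp_intrE => ->.
Qed.

Lemma piG_eqZ X X' : piG X = piG X' <-> forall i, nu N a i * (X i - X' i) = 0.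
Proof.
by rewrite piG_eq; split=> h i; have := h i; rewrite Zp_intrE.
Qed.

Lemma piG_sub (X X' : 'I_r -> A) : piG (fun i => X i - X' i) = piG X - piG X'.
Proof.
have -> : piG X - piG X' = \sum_i g i *~ ((X i : nat)%:Z - (X' i : nat)%:Z).
  by rewrite -sumrB; apply: eq_bigr => i _; rewrite mulrzBr.
by apply/piG_eq => i; rewrite intrB !Zp_intrE subrr mulr0.
Qed.

Lemma piG_surj x : exists X, piG X = x.
Proof.
have [_ _ span _] := bas; have [c ->] := span x.
exists (fun i => (c i)%:R); rewrite (eq_bigr (fun i => g i *~ (c i)%:Z)).
  by apply/piG_eq => i; rewrite pmulrn subrr mulr0.
by move=> i _; rewrite pmulrn.
Qed.

Variable n : nat.

Definition fam (X : 'M[A]_(n, r)) : {ffun 'I_n -> G} := [ffun k => piG (X k)].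
Definition gen (f : {ffun 'I_n -> G}) : bool :=
  `[< forall x, exists v : 'cV[int]_n, x = \sum_k f k *~ v k 0 >].

Lemma card_fam_fibre f :
  #|[set X : 'M[A]_(n, r) | fam X == f]%SET| = (ker_card N a ^ n)%N.
Proof.
have /choice[c cP] : forall k, exists X, piG X = f k by move=> k; exact: piG_surj.
pose X0 : 'M[A]_(n, r) := \matrix_(k, i) c k i.
have inj : injective (fun X : 'M[A]_(n, r) => X - X0) by move=> x y; exact: addIr.
have <- : #|[set X : 'M[A]_(n, r) | [forall k, forall i,
    X k i \in [set x : A | nu N a i * x == 0]]]%SET| = (ker_card N a ^ n)%N.
  rewrite card_mx_box (eq_bigr (fun=> ker_card N a)) => [|k _].
    by rewrite prod_nat_const card_ord.
  by apply: eq_bigr => i _; rewrite (card_nu_kernel N_gt1 basis_a2_dvd).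
rewrite -[RHS](card_preimset _ inj); apply: eq_card => X; rewrite !inE.
apply/eqP/forallP => [/ffunP h k|h].
  apply/forallP => i; rewrite inE !mxE; apply/eqP; move: i; apply/piG_eqZ.
  by have := h k; rewrite ffunE -cP.
apply/ffunP => k; rewrite ffunE -cP; apply/piG_eqZ => i.
by have /forallP/(_ i) := h k; rewrite inE !mxE => /eqP.
Qed.

Lemma card_fam_preim (S : {set {ffun 'I_n -> G}}) :
  #|[set X : 'M[A]_(n, r) | fam X \in S]%SET| = (#|S| * ker_card N a ^ n)%N.
Proof.
rewrite -sum1_card (partition_big fam [in S]) /=; last by move=> X; rewrite inE.
rewrite -sum_nat_const; apply: eq_bigr => f fS.
rewrite -(card_fam_fibre f) -sum1_card; apply: eq_bigl => X; rewrite !inE.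
by case: eqP => [->|]; rewrite ?fS ?andbF.
Qed.

(** Integer combinations of the entries of [y] stay in the subgroup [H], and every element of [H] is
    itself an entry. The images of the entries thus generate [G] exactly when [H] maps onto [G]. *)
Lemma gen_onto (F : numFieldType) (z : F) d (y : {ffun 'I_n -> V}) H :
  N.-primitive_root z -> lagrangian (bz a d) (qz a d) (lag_card N a) H ->
  spans y H -> gen (fam (fst_mx y)) = onto a H.
Proof.
move=> prim_z lagH [yH Hy].
have [H0 HB] := lagrangian_subgroup N_gt1 basis_a_gt0 basis_a2_dvd prim_z lagH.
have [pi piE] : exists pi : {additive V -> G}, pi =1 fun x => piG (x 0).
  apply: additive_exists => x x' /=; rewrite -piG_sub.
  by apply: eq_bigr => i _; rewrite !mxE.
have fE k : fam (fst_mx y) k = pi (y k).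
  by rewrite ffunE piE; apply: eq_bigr => i _; rewrite mxE.
have HN x : x \in H -> - x \in H by move=> xH; rewrite -sub0r HB.
have HD : {in H &, forall x y, x + y \in H}.
  by move=> x x' xH x'H; rewrite -[x']opprK HB // HN.
have HM x m : x \in H -> x *+ m \in H.
  by move=> xH; elim: m => [|m IH]; rewrite ?mulr0n // mulrS HD.
have HZ x (t : int) : x \in H -> x *~ t \in H.
  by move=> xH; case: t => m; rewrite ?NegzE ?mulrNz -?pmulrn ?HN // HM.
apply/asboolP/forallP => [h X|h x].
  have [v xE] := h (piG (X 0)).
  apply/exists_inP; exists (\sum_k y k *~ v k 0).
    by apply: (big_ind (fun u : V => u \in H)) => [//|u w uH wH|k _]; [exact: HD|exact: HZ].
  apply/forallP => i; apply/eqP; move: i; apply/piG_eqZ.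
  rewrite -piE xE raddf_sum; apply: eq_bigr => k _.
  by rewrite raddfMz -fE.
have [X XE] := piG_surj x.
have /exists_inP[y' y'H /forallP y'X] := h (\row_i X i).
have [k kE] := Hy _ y'H; exists (delta_mx k 0).
rewrite (bigD1 k) //= mxE !eqxx big1 ?addr0 => [|l /negPf lk]; last by rewrite mxE lk mulr0z.
rewrite fE kE piE -XE; apply/piG_eqZ => i.
by have := y'X i; rewrite mxE -[_ - _]opprB mulrN oppr_eq0 => /eqP.
Qed.

Variables (pG : sym_pairing G) (eps : 'I_r -> dual G) (Q : 'I_r -> 'I_r -> int).
Hypothesis epsP : forall i (c : 'I_r -> int),
  eps i (\sum_j g j *~ c j) = toQmodZ ((c i)%:~R / (a i)%:R).
Hypothesis QP : forall i j,
  pG (eps i) (eps j) = toQmodZ ((Q i j)%:~R / (a i * a j)%:R).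

Let QZ i j : A := (Q i j)%:~R.

Variable M : 'M[int]_n.
Hypothesis symM : M^T = M.

Let mZ : 'M[A]_n := map_mx intr M.

Lemma col_condP X : (forall l, \sum_k fam X k *~ M k l = 0) <->
  [forall l, forall i, col_cond a mZ X l i == 0].
Proof.
have [_ _ _ rel] := bas.
have e l : \sum_k fam X k *~ M k l = \sum_i g i *~ \sum_k (X k i : nat)%:Z * M k l.
  transitivity (\sum_k \sum_i g i *~ ((X k i : nat)%:Z * M k l)).
    apply: eq_bigr => k _; rewrite ffunE mulrz_suml; apply: eq_bigr => i _.
    by rewrite mulrzA.
  by rewrite exchange_big; apply: eq_bigr => i _; rewrite mulrz_sumr.
have e' l i : col_cond a mZ X l i = nu N a i * (\sum_k (X k i : nat)%:Z * M k l)%:~R.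
  congr (_ * _); rewrite rmorph_sum; apply: eq_bigr => k _.
  by rewrite rmorphM /= Zp_intrE mxE.
split=> [h|/forallP h l].
  apply/forallP => l; apply/forallP => i; rewrite e' nu_intr_eq0.
  by move: i; apply/rel; rewrite -e.
rewrite e; apply/rel => i; rewrite -nu_intr_eq0 -e'; exact: (forallP (h l)).
Qed.

Lemma pair_condP X (F : {additive cok M -> G}) :
  (forall k, F (tocok M (delta_mx k 0)) = fam X k) ->
  (forall u v : dual G, cok_pairing (u \o F) (v \o F) = pG u v) <->
  [forall i, forall j, pair_cond a mZ X QZ i j == 0].
Proof.
move=> FE; rewrite (pairing_on_basis bas epsP pG symM).
have FE' k : F (tocok M (delta_mx k 0)) = \sum_i g i *~ (X k i : nat)%:Z.
  by rewrite FE ffunE.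
have e (i j : 'I_r) : (i <= j)%N -> (pair_cond a mZ X QZ i j == 0) =
   ((a i * a j)%N%:Z %| \sum_k \sum_l (X k i : nat)%:Z * M k l * (X l j : nat)%:Z - Q i j)%Z.
  move=> ij; rewrite -(Zp_quot_mul_intr_eq0 N_gt1) ?basis_a2_dvd //.
  rewrite /pair_cond /nu2 ij; congr (_ * _ == 0); rewrite rmorphB; congr (_ - _).
  rewrite rmorph_sum; apply: eq_bigr => k _; rewrite rmorph_sum; apply: eq_bigr => l _.
  by rewrite !rmorphM /= !Zp_intrE mxE.
have a0 i j : (0 < a i * a j)%N by rewrite muln_gt0 !basis_a_gt0.
have e2 (i j : 'I_r) : (i <= j)%N -> cok_pairing (eps i \o F) (eps j \o F) = pG (eps i) (eps j) <->
    pair_cond a mZ X QZ i j == 0.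
  move=> ij; rewrite (cok_pairing_eps epsP symM i j FE') QP toQmodZ_eq e //.
  by rewrite -mulrBl -intrB; exact: rat_div_int.
split=> [h|/forallP h i j ij]; last by apply/(e2 _ _ ij); exact: (forallP (h i)).
apply/forallP => i; apply/forallP => j; have [ij|ij] := leqP i j.
  by apply/(e2 _ _ ij); exact: h.
by rewrite /pair_cond nu2_gt // mul0r.
Qed.

(** A homomorphism is a tuple of images of the standard basis vectors, and each tuple has
    [ker_card N a ^ n] lifts [X]. *)
Lemma num_Surstar_count :
  (num_Surstar M pG * ker_card N a ^ n)%N =
  #|[set X : 'M[A]_(n, r) | gen (fam X) && cond a mZ QZ X]%SET|.
Proof.
rewrite num_Surstar_card -card_fam_preim; apply: eq_card => X; rewrite !inE.
apply/asboolP/idP => [[F [surF pairF] FE]|/and3P[/asboolP genX colX pairX]].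
  apply/and3P; split.
  - apply/asboolP => x; have [c <-] := surF x; have [v <-] := tocok_surj c.
    by exists v; rewrite hom_tocok; apply: eq_bigr => k _; rewrite FE.
  - apply/col_condP => l.
    have := hom_tocok F (col l M); rewrite (_ : tocok M (col l M) = 0).
      by rewrite raddf0 => e0; rewrite [RHS]e0; apply: eq_bigr => k _; rewrite mxE FE.
    rewrite -(raddf0 (tocok M)); apply/tocok_eq; exists (delta_mx l 0).
    by rewrite subr0 colE.
  by rewrite -(pair_condP FE).
have [F FE] := hom_tocok_exists (iffRL (col_condP X) colX).
have FE' k : F (tocok M (delta_mx k 0)) = fam X k.
  rewrite FE (bigD1 k) //= mxE !eqxx big1 ?addr0 // => l /negPf lk.
  by rewrite mxE lk mulr0z.
exists F => //; split; last by rewrite (pair_condP FE').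
by move=> x; have [v ->] := genX x; exists (tocok M v); rewrite FE.
Qed.

End Model.

(** * Laws of finite-valued variables and of the matrix modulo [m ^ 2] *)

Section FiniteValued.
Context {d : measure_display} {T : measurableType d} {R : realType}.
Variables (P : probability T R) (F : finType) (phi : T -> F).
Hypothesis mphi : forall s, measurable (phi @^-1` [set s])%classic.

Definition law s : R := fine (P (phi @^-1` [set s])%classic).

Lemma lawE s : P (phi @^-1` [set s])%classic = (law s)%:E.
Proof. by rewrite /law fineK // fin_num_measure. Qed.

Lemma law_ge0 s : 0 <= law s.
Proof. by rewrite -lee_fin -lawE measure_ge0. Qed.

Lemma integral_finite_valued (h : F -> R) : (forall s, 0 <= h s) ->
  (\int[P]_w (h (phi w))%:E = (\sum_s h s * law s)%:E)%E.
Proof.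
move=> h0.
transitivity (\int[P]_w (\sum_(s <- index_enum F)
    ((h s)%:E * (\1_(phi @^-1` [set s])%classic w)%:E)))%E.
  apply: eq_integral => w _; rewrite (bigD1 (phi w)) //= big1 ?adde0.
    by rewrite indicE mem_set //= mule1.
  by move=> s sw; rewrite indicE memNset ?mule0 //= => e; rewrite e eqxx in sw.
rewrite ge0_integral_sum //; last first.
- by move=> s w _; rewrite mule_ge0 // lee_fin.
- move=> s; apply/measurable_funeM/measurable_EFinP; exact: measurable_indic.
rewrite -sumEFin; apply: eq_bigr => s _.
rewrite ge0_integralZl_EFin //; last first.
- by apply/measurable_EFinP; exact: measurable_indic.
by rewrite integral_indic // classical_sets.setIT EFinM -lawE.
Qed.

Lemma measurable_finite_preimage (B : pred F) : measurable [set w | B (phi w)]%classic.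
Proof.
have -> : [set w | B (phi w)]%classic =
    (\bigcup_(s in [set` [set s | B s]%SET]) (phi @^-1` [set s]))%classic.
  apply/seteqP; split=> [w Bw|w [s]] /=; last by rewrite inE => Bs ->.
  by exists (phi w) => //=; rewrite inE.
by apply: fin_bigcup_measurable.
Qed.

Lemma sum_law (B : pred F) : (\sum_(s | B s) law s)%:E = P [set w | B (phi w)]%classic.
Proof.
have mB := measurable_finite_preimage B.
rewrite -[X in P X]classical_sets.setIT -integral_indic //.
rewrite big_mkcond /= (eq_bigr (fun s => (B s)%:R * law s)) => [|s _].
  rewrite -(integral_finite_valued (h := fun s => (B s)%:R)) //.
  apply: eq_integral => w _; rewrite indicE; congr ((nat_of_bool _)%:R%:E).
  by apply/idP/idP => [Bw|]; [rewrite mem_set|rewrite inE].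
by case: (B s); rewrite ?mul1r ?mul0r.
Qed.

Lemma sum_law1 : \sum_s law s = 1.
Proof.
apply: EFin_inj; rewrite (sum_law predT) /= -[RHS](probability_setT P).
by congr (P _); apply/seteqP; split.
Qed.

End FiniteValued.

Section ModularBalance.
Variable m : nat.
Hypothesis m_gt1 : (1 < m)%N.
Local Notation N := (m ^ 2)%N.
Let N_gt1 : (1 < N)%N. Proof. by rewrite -(exp1n 2) ltn_sqr. Qed.

(** [t x = t y] modulo [N] forces [q = N / gcd (t, N)] to divide [x - y]. Since [q > 1] divides
    [m ^ 2], a prime factor of [q] divides [m]; this lets balance modulo [m] control characters
    modulo [m ^ 2]. *)
Lemma annihilated_mod_prime (t : 'Z_(m ^ 2)) : t != 0 ->
  exists p, [/\ prime p, (p %| m)%N & forall x y : int,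
    t * x%:~R = t * y%:~R -> x%:~R = y%:~R :> 'F_p].
Proof.
move=> t0; have N0 : (0 < N)%N by exact: ltnW.
have tn0 : (0 < (t : nat))%N by rewrite lt0n; apply: contraNneq t0 => e; apply/eqP/val_inj.
have tN : (t < N)%N by rewrite -[X in (_ < X)%N](Zp_cast N_gt1) ltn_ord.
pose e := gcdn t N; have e0 : (0 < e)%N by rewrite gcdn_gt0 tn0.
have eN : (e %| N)%N by exact: dvdn_gcdr.
have eT : (e %| t)%N by exact: dvdn_gcdl.
pose q := (N %/ e)%N.
have q1 : (1 < q)%N.
  rewrite ltn_divRL // mul1n; apply: leq_ltn_trans tN; exact: dvdn_leq.
exists (pdiv q); have pp := pdiv_prime q1; split=> //.
  have : (pdiv q %| N)%N by apply: dvdn_trans (pdiv_dvd q) _; exact: dvdn_div.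
  by rewrite Euclid_dvdX // => /andP[].
move=> x y /eqP; rewrite -subr_eq0 -mulrBr -intrB -{1}[t]natr_Zp pmulrn -intrM.
rewrite Zp_intr_eq0 // dvdzE abszM /= => h.
have qd : (q %| `|(x - y)|)%N.
  have : (q * e %| (t %/ e * `|(x - y)|) * e)%N.
    by rewrite mulnAC !divnK.
  rewrite dvdn_pmul2r // Gauss_dvdr // /q /e.
  by rewrite coprime_sym /coprime -(eqn_pmul2r e0) muln_gcdl !divnK // mul1n.
apply/eqP; rewrite -subr_eq0 -intrB.
have pd : (pdiv q %| `|(x - y)|)%N by exact: dvdn_trans (pdiv_dvd q) qd.
move: pd; rewrite (dvdn_pcharf (pchar_Fp pp)).
by case: (x - y) => k; rewrite ?NegzE ?abszN /= ?mulrNz ?oppr_eq0 -?pmulrn.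
Qed.

End ModularBalance.

Section MatrixLaw.
Context {d : measure_display} {T : measurableType d} {R : realType}.
Variables (P : probability T R) (alpha : R) (m n : nat) (M : T -> 'M[int]_n).
Hypotheses (m_gt1 : (1 < m)%N) (randM : random_sym_matrix P alpha m M).

Local Notation A := 'Z_(m ^ 2).
Implicit Types p : 'I_n * 'I_n.

(* The entries of [M] modulo [m ^ 2] on and above the diagonal, completed by
   zeros, so that all entries are independent. *)
Definition upper_entry p (w : T) : A :=
  if (p.1 <= p.2)%N then (M w p.1 p.2)%:~R else 0.
Definition upper_mx (w : T) : {ffun 'I_n * 'I_n -> A} := [ffun p => upper_entry p w].
Definition entry_law p : A -> R := law P (upper_entry p).

Lemma measurable_upper_entry p s : measurable (upper_entry p @^-1` [set s])%classic.
Proof.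
have [mM _ _ _] := randM.
have [pD|pD] := boolP (p.1 <= p.2)%N.
  rewrite (_ : _ @^-1` _ =
    (fun w => M w p.1 p.2) @^-1` [set t : int | t%:~R = s])%classic; first exact: mM.
  by apply/seteqP; split=> w /=; rewrite /upper_entry pD.
have e w : upper_entry p w = 0 by rewrite /upper_entry (negPf pD).
have [->|s0] := eqVneq s 0.
  by rewrite (_ : _ @^-1` _ = setT)%classic //; apply/seteqP; split=> w //= _; rewrite e.
rewrite (_ : _ @^-1` _ = set0)%classic //; apply/seteqP; split=> // w /=; rewrite e => e0.
by rewrite -e0 eqxx in s0.
Qed.

Lemma upper_mx_preim (S : {ffun 'I_n * 'I_n -> A}) :
  (upper_mx @^-1` [set S] =
   \bigcap_(p in setT) (upper_entry p @^-1` [set S p]))%classic.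
Proof.
apply/seteqP; split=> [w <- p _|w h] /=; first by rewrite ffunE.
by apply/ffunP => p; rewrite ffunE; exact: h.
Qed.

Lemma measurable_upper_mx S : measurable (upper_mx @^-1` [set S])%classic.
Proof.
rewrite upper_mx_preim; apply: fin_bigcap_measurable; first exact: finite_finset.
by move=> p _; exact: measurable_upper_entry.
Qed.

(** If [S] vanishes below the diagonal, independence gives the product over [k <= l] and the other
    factors are [1]; otherwise both sides are [0]. *)
Lemma law_upper_mx S : law P upper_mx S = \prod_p entry_law p (S p).
Proof.
have [mM _ indep _] := randM.
pose D := [set p : 'I_n * 'I_n | (p.1 <= p.2)%N]%SET.
apply: EFin_inj; rewrite -lawE; last exact: measurable_upper_mx.
have [/forall_inP S0|] := boolP [forall (p | p \notin D), S p == 0].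
  have -> : (upper_mx @^-1` [set S] = \bigcap_(p in [set` D])
      (fun w => M w p.1 p.2) @^-1` [set t : int | t%:~R = S p])%classic.
    rewrite upper_mx_preim; apply/seteqP; split=> w h p /=.
      by rewrite inE => pD; have := h p I; rewrite /= /upper_entry pD.
    move=> _; rewrite /upper_entry; case: ifP => pD.
      by apply: (h p); rewrite /= inE.
    by apply/esym/eqP/S0; rewrite inE pD.
  have -> : \prod_p entry_law p (S p) = \prod_(p in D) entry_law p (S p).
    rewrite (bigID [in D]) /= [X in _ * X]big1 ?mulr1 // => p pD.
    have := pD; rewrite inE => /negPf pD'.
    apply: EFin_inj; rewrite -lawE; last exact: measurable_upper_entry.
    rewrite -[RHS](probability_setT P); congr (P _); apply/seteqP; split=> w //= _.
    by rewrite /upper_entry pD'; apply/esym/eqP/S0.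
  rewrite (indep D (fintype.subxx D)) -prodEFin; apply: eq_bigr => p; rewrite inE => pD.
  rewrite -lawE; last exact: measurable_upper_entry.
  by congr (P _); apply/seteqP; split=> w /=; rewrite /upper_entry pD.
rewrite negb_forall_in => /exists_inP[p pD Sp].
have pD' : (p.1 <= p.2)%N = false by move: pD; rewrite inE => /negPf.
have e0 : (upper_entry p @^-1` [set S p] = set0)%classic.
  apply/seteqP; split=> // w /=; rewrite /upper_entry pD' => e.
  by rewrite -e eqxx in Sp.
rewrite (bigD1 p) //= (_ : entry_law p (S p) = 0) ?mul0r; last first.
  by rewrite /entry_law /law e0 measure0.
rewrite (_ : (upper_mx @^-1` [set S])%classic = set0) ?measure0 //.
by rewrite upper_mx_preim; apply/seteqP; split=> // w h; rewrite -e0; exact: h.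
Qed.

Lemma sym_upper_mx w : sym_mx (upper_mx w) = map_mx intr (M w).
Proof.
have [_ symM _ _] := randM.
apply/matrixP => k l; rewrite !mxE !ffunE /upper_entry /=.
have [//|lk] := leqP k l; rewrite (ltnW lk).
by rewrite -[in RHS](symM w) mxE.
Qed.

Lemma entry_law_balanced p (t s : A) : (p.1 <= p.2)%N -> t != 0 ->
  \sum_(s' | t * s' == t * s) entry_law p s' <= 1 - alpha.
Proof.
move=> pD t0; have [mM _ _ bal] := randM.
have [q [qp qm hq]] := annihilated_mod_prime m_gt1 t0.
rewrite -lee_fin sum_law; last exact: measurable_upper_entry.
apply: le_trans (bal p.1 p.2 pD q qp qm (s : nat)%:R).
apply: le_measure; rewrite ?inE.
- exact: (measurable_finite_preimage (measurable_upper_entry p) (fun x => t * x == t * s)).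
- exact: (mM p.1 p.2 [set x : int | x%:~R = (s : nat)%:R]%classic).
move=> w /=; rewrite /upper_entry pD => /eqP e.
rewrite [RHS]pmulrn; apply: hq; rewrite e; congr (_ * _).
by rewrite -pmulrn natr_Zp.
Qed.

End MatrixLaw.

(** * Passage to the exponential bound and assembly *)

Lemma pow_le_expR (R : realType) (tau c : R) n : 0 < tau -> c < - ln tau ->
  tau ^+ n <= expR (- c * n%:R).
Proof.
move=> tau0 ct; rewrite -{1}(lnK (_ : tau \is Num.pos)) ?posrE //.
rewrite -expRM_natl ler_expR mulrC ler_wpM2r //; lra.
Qed.

Lemma num_Surstar_trivial (G : finZmodType) (pG : sym_pairing G) n (M : 'M[int]_n) :
  #|G| = 1%N -> M^T = M -> num_Surstar M pG = 1%N.
Proof.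
move=> G1 symM.
have G0 (x : G) : x = 0.
  have /fintype_le1P h : (#|G| <= 1)%N by rewrite G1.
  exact: h.
rewrite num_Surstar_card (_ : [set f | _]%SET = finset.setT).
  by rewrite cardsT card_ffun G1 exp1n.
apply/setP => f; rewrite !inE; apply/asboolP.
exists (\0 : {additive cok M -> G}); last by move=> k; rewrite (G0 (f k)).
split=> [x|u v]; first by exists 0; rewrite (G0 x).
rewrite (_ : u = (\0 : dual G)); last by apply: additive_ext => x; rewrite (G0 x) raddf0.
by rewrite pairing0l -(cok_pairing0l symM (v \o \0)).
Qed.

Theorem theorem8p1 (R : realType) (alpha : R) (G : finZmodType)
  (pG : sym_pairing G) (alpha_gt0 : 0 < alpha) (alpha_lt1 : alpha < 1) :
  exists2 c0 : R, 0 < c0 &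
  forall c : R, 0 < c -> c < c0 ->
  exists2 K : R, 0 < K &
  forall (n : nat) (d : measure_display) (T : measurableType d)
    (P : probability T R) (M : T -> 'M[int]_n),
  random_sym_matrix P alpha #|G| M ->
  (`| 'E_P[fun w => (num_Surstar (M w) pG)%:R] - (#|G|%:R^-1)%:E |
     <= (K * expR (- c * n%:R))%:E)%E.
Proof.
(* ['Z_1] has two elements, so arithmetic modulo [#|G| ^ 2] is faithful only for [#|G| > 1]; the
   trivial group is treated apart. *)
have [G1|G1] := leqP #|G| 1.
  have G1' : #|G| = 1%N by apply/eqP; rewrite eqn_leq G1; apply/card_gt0P; exists 0.
  exists 1 => // c _ _; exists 1 => // n d T P M [_ symM _ _].
  rewrite (_ : (fun w => _) = cst 1); last first.
    by apply/funext => w; rewrite num_Surstar_trivial.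
  by rewrite expectation_cst G1' invr1 subee // abse0 lee_fin mul1r expR_ge0.
have [r [g [a bas]]] := exists_basis G.
have N1 := sqr_card_gt1 G1; have a0 := basis_a_gt0 bas; have a2 := basis_a2_dvd bas.
have [_ aG _ _] := bas.
have [z prim_z] := @closed_prim_root_exists R[i] (#|G| ^ 2)%N (ltnW N1).
have [eps epsP] := dual_basis_exists bas.
have [Q QP] := pairing_int_exists bas epsP pG.
have [rho [rho0 rho1 hrho]] := fourier_bound N1 prim_z alpha_gt0 alpha_lt1.
have [tau [K [tau0 tau1 K0 hK]]] := averaged_estimate N1 a0 a2 prim_z rho0 rho1.
(* [c < - ln tau] means [tau < expR (- c)]. Below, [K + 1] replaces [K], which may be [0]. *)
exists (- ln tau); first by rewrite oppr_gt0 ln_lt0 // tau0.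
move=> c c0 ctau; exists (K + 1); first lra.
move=> n d T P M randM; have [_ symM _ _] := randM.
pose QZ i j : 'Z_(#|G| ^ 2) := (Q i j)%:~R.
pose ker := (ker_card (#|G| ^ 2) a ^ n)%N.
pose cnt (S : {ffun 'I_n * 'I_n -> 'Z_(#|G| ^ 2)}) :=
  #|[set X | gen (fam g X) && cond a (sym_mx S) QZ X]%SET|.
have ker0 : ker%:R != 0 :> R.
  rewrite pnatr_eq0 -lt0n expn_gt0; have := lag_card_gt0 N1 a0 a2.
  by rewrite /lag_card muln_gt0 => /andP[_ ->].
pose mu := entry_law P M (m := #|G|).
pose EN : R := \sum_S (cnt S)%:R / ker%:R * \prod_p mu p (S p).
have EE : ('E_P[fun w => (num_Surstar (M w) pG)%:R] = EN%:E)%E.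
  rewrite unlock (_ : (fun w => _) = (fun w => ((cnt (upper_mx #|G| M w))%:R / ker%:R)%:E)).
    rewrite (@integral_finite_valued _ _ _ P _ _ (measurable_upper_mx randM)
      (fun S => (cnt S)%:R / ker%:R)) => [|S]; last by rewrite divr_ge0.
    by congr (_%:E); apply: eq_bigr => S _; rewrite (law_upper_mx randM).
  apply/funext => w; congr (_%:E); apply: (mulIf ker0); rewrite divfK // -natrM.
  congr _%:R; rewrite /ker (num_Surstar_count bas G1 epsP (fun i j => let: And3 h _ _ := QP i j in h)) //.
  by rewrite /cnt (sym_upper_mx randM).
rewrite EE -EFinB abse_EFin lee_fin.
apply: (@le_trans _ _ (K * tau ^+ n)); last first.
  apply: ler_pM => //; [by rewrite exprn_ge0 // ltW|lra|exact: pow_le_expR].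
have damp : damped rho (fun p => fourier z (mu p)).
  have mE p := measurable_upper_entry randM p.
  split=> [p|p t pD t0]; first by apply: fourier0; exact: sum_law1 (mE p).
  apply: hrho => // [s||s]; [exact: law_ge0 (mE p) s|exact: sum_law1 (mE p)|].
  exact: (entry_law_balanced G1 randM).
have Ql i j : nu (#|G| ^ 2) a i * QZ i j = 0.
  by apply/eqP; rewrite (nu_intr_eq0 bas G1); have [] := QP i j.
have Qr i j : nu (#|G| ^ 2) a j * QZ i j = 0.
  by apply/eqP; rewrite (nu_intr_eq0 bas G1); have [] := QP i j.
have := hK n _ (fun y => gen (fam g (fst_mx y))) QZ damp
  (fun d' y H => gen_onto bas G1 prim_z) Ql Qr.
rewrite -(expected_count a N1 prim_z mu QZ (genX := fun X => gen (fam g X)) (fun y => erefl)).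
set Y := \sum_S _; have YE : EN = Y / ker%:R.
  by rewrite /EN /Y mulr_suml; apply: eq_bigr => S _; rewrite mulrC mulrA.
rewrite aG; set L := _ * _ * _.
(* [D ^ n = N ^ (n * r) * ker]: the powers of [N] from the character expansion cancel, and dividing
   by [ker] passes from lifts to homomorphisms. *)
have -> : L = EN%:C%C.
  have kerC : ker%:R != 0 :> R[i] by rewrite pnatr_eq0 -(pnatr_eq0 R).
  have NC k : ((#|G| ^ 2) ^ k)%:R != 0 :> R[i].
    by rewrite pnatr_eq0 -lt0n expn_gt0 (ltnW N1).
  have DE : (lag_card (#|G| ^ 2) a)%:R ^+ n = ((#|G| ^ 2) ^ (n * r))%:R * ker%:R :> R[i].
    by rewrite -natrX -natrM [(n * r)%N]mulnC expnM /ker -expnMn.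
  have -> : EN%:C%C = Y%:C%C / ker%:R.
    by rewrite YE rmorphM fmorphV (rmorph_nat (real_complex R)).
  rewrite /L DE.
  move: (NC (n * r)%N) (NC (r * r)%N) kerC; move: (_%:R) (_%:R) (_%:R) (_%:C%C) => u v w x.
  by move=> u0 v0 w0; field; rewrite u0 v0 w0.
rewrite -(rmorph_nat (real_complex R)) -fmorphV -rmorphB normc_def /= expr0n /= addr0.
by rewrite sqrtr_sqr lecR.
Qed.
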